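(* Let $\kappa$ be a regular uncountable cardinal and $\lambda\ge\kappa$ a cardinal. Let $R$ be a ring of size $<\kappa$, let $A$ and $B$ be $R$-modules, and suppose $\{R,A,B\}\subset\mathfrak{N}\prec\mathfrak{H}_\lambda$, where $\mathfrak{N}\in\wp^*_\kappa(H_\lambda)$ is a 0-guessing model (in particular $\mathfrak{N}\cap\kappa\in\kappa$). Then: (i) For all $n\in\mathbb{N}$, $$\mathfrak{N}\cap\mathrm{Ext}^n_R(A,B)\ \simeq\ \mathrm{Ext}^n_R\big(\mathfrak{N}\cap A,\ \mathfrak{N}\cap B\big).$$ In particular, $\mathrm{Ext}^n_R(A,B)=0$ if and only if $\mathrm{Ext}^n_R(\mathfrak{N}\cap A,\mathfrak{N}\cap B)=0$. (ii) Every homomorphism from $\mathfrak{N}\cap A$ to $\mathfrak{N}\cap B$ lifts to a homomorphism from $A$ to $B$. In particular, if $B$ is also a subset of $\mathfrak{N}$, then every homomorphism from $\mathfrak{N}\cap A$ to $B$ lifts to a homomorphism from $A$ to $B$.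
   Context: The background theory is ZFC. Modules are left $R$-modules. $H_\lambda$ is the set of all sets of hereditary cardinality $<\lambda$ (transitive closure of size $<\lambda$), and $\mathfrak{H}_\lambda=(H_\lambda,\in)$. For a regular uncountable cardinal $\kappa$ and a cardinal $\lambda\ge\kappa$, $\wp^*_\kappa(H_\lambda)$ is the set of $N\subset H_\lambda$ such that $|N|<\kappa$, $N\cap\kappa\in\kappa$ (i.e. $N\cap\kappa$ is an ordinal below $\kappa$), and $\mathfrak{N}=(N,\in)$ is an elementary substructure of $\mathfrak{H}_\lambda$; $N$ and $\mathfrak{N}$ are identified. $\mathfrak{H}(\mathfrak{N})$ denotes the Mostowski (transitive) collapse of $\mathfrak{N}$. Such an $\mathfrak{N}$ is 0-guessing if the order type $\mu$ of $\mathfrak{N}\cap\lambda$ is a cardinal and $\mathfrak{H}(\mathfrak{N})=\mathfrak{H}_\mu$. Under the hypotheses $R\subset\mathfrak{N}$, so for every $R$-module $M\in\mathfrak{N}$ the intersection $\mathfrak{N}\cap M$ of $\mathfrak{N}$ with (the underlying set of) $M$ is a submodule of $M$. A homomorphism $\phi:\mathfrak{N}\cap A\to\mathfrak{N}\cap B$ lifts to $\widetilde\phi:A\to B$ if $\widetilde\phi$ extends $\phi$ as a function. *)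

(* Defs.v *)
From HB Require Import structures.
From mathcomp Require Import all_boot all_order all_algebra.
From mathcomp Require Import generic_quotient ring_quotient finmap.
From mathcomp Require Import mathcomp_extra boolp classical_sets functions.
From mathcomp Require Import cardinality fsbigop.
From Stdlib Require Import Relation_Operators.

Set Implicit Arguments.
Unset Strict Implicit.
Unset Printing Implicit Defensive.

Import GRing.Theory.

Local Open Scope classical_set_scope.
Local Open Scope card_scope.
Local Open Scope ring_scope.
Local Open Scope quotient_scope.

(* Separation and replacement range over arbitrary predicates, so the subsets *)
(* of, and the functions between, elements of the universe are the ambient    *)
(* ones, and its natural numbers are standard.                                *)
Structure zfcUniverse := ZfcUniverse {
  zfc_sort :> Type;
  zin : zfc_sort -> zfc_sort -> Prop;
  zfc_extensionality : forall x y, (forall z, zin z x <-> zin z y) -> x = y;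
  zfc_foundation : forall x, (exists y, zin y x) ->
    exists y, zin y x /\ forall z, zin z x -> ~ zin z y;
  zfc_pairing : forall x y, exists p, forall z, zin z p <-> z = x \/ z = y;
  zfc_union : forall x, exists u, forall z,
    zin z u <-> exists y, zin y x /\ zin z y;
  zfc_powerset : forall x, exists p, forall z,
    zin z p <-> forall y, zin y z -> zin y x;
  zfc_separation : forall (P : zfc_sort -> Prop) x,
    exists s, forall z, zin z s <-> zin z x /\ P z;
  zfc_replacement : forall (F : zfc_sort -> zfc_sort -> Prop) x,
    (forall y z z', zin y x -> F y z -> F y z' -> z = z') ->
    exists s, forall z, zin z s <-> exists y, zin y x /\ F y z;
  zfc_infinity : exists w,
    (exists e, zin e w /\ forall z, ~ zin z e) /\
    (forall x, zin x w ->
      exists s, zin s w /\ forall z, zin z s <-> zin z x \/ z = x);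
  zfc_choice : forall x,
    (forall y, zin y x -> exists z, zin z y) ->
    (forall y y' z, zin y x -> zin y' x -> zin z y -> zin z y' -> y = y') ->
    exists c, forall y, zin y x -> exists! z, zin z y /\ zin z c
}.

Notation "x ∈ y" := (zin x y) (at level 70, no associativity).

Section SetTheory.
Variable U : zfcUniverse.
Implicit Types (x y z a b : U) (P N : set U).

Definition elems x : set U := [set y | y ∈ x].

(* {x | P x} as an element of U; meaningless when P is a proper class. *)
Definition set_of P : U :=
  if pselect (exists x, elems x = P) is left h then projT1 (cid h)
  else projT1 (cid (zfc_infinity U)).

Definition opair x y : U :=
  set_of [set set_of [set x]; set_of [set x; y]].

Definition is_transitive P := forall x y, P x -> y ∈ x -> P y.

Definition is_ordinal x :=
  is_transitive (elems x) /\ forall y, y ∈ x -> is_transitive (elems y).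

Definition is_cardinal k :=
  is_ordinal k /\ forall a, a ∈ k -> ~ (elems a #= elems k).

(* |X| < k, for a cardinal k *)
Definition card_lt T (X : set T) k := exists a, a ∈ k /\ X #= elems a.

Definition is_regular k :=
  forall a (f : U -> U), a ∈ k -> (forall x, x ∈ a -> f x ∈ k) ->
    exists b, b ∈ k /\ forall x, x ∈ a -> f x ∈ b.

Definition regular_uncountable_cardinal k :=
  [/\ is_cardinal k, is_regular k & ~ countable (elems k)].

Definition trcl x : set U := [set y | clos_trans U (@zin U) y x].

Definition Hset k : set U := [set x | card_lt (trcl x) k].

(* o is the order type of the set P of ordinals *)
Definition order_type P o :=
  is_ordinal o /\
  exists2 f : U -> U, set_bij P (elems o) f &
    forall x y, P x -> P y -> (x ∈ y <-> f x ∈ f y).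

Inductive formula :=
| FMem of nat & nat
| FEq of nat & nat
| FNot of formula
| FAnd of formula & formula
| FAll of nat & formula.

(* truth of p in (P, ∈), the variable 'i being interpreted by e i *)
Fixpoint sat P (e : nat -> U) (p : formula) : Prop :=
  match p with
  | FMem i j => e i ∈ e j
  | FEq i j => e i = e j
  | FNot q => ~ sat P e q
  | FAnd q r => sat P e q /\ sat P e r
  | FAll i q => forall x, P x -> sat P (fun j => if j == i then x else e j) q
  end.

Definition elementary N P :=
  N `<=` P /\
  forall p e, (forall i, N (e i)) -> (sat N e p <-> sat P e p).

(* A subset N of U of size < k is an element of U, by replacement. *)
Definition Pstar k l N :=
  [/\ card_lt N k,
      exists d, d ∈ k /\ N `&` elems k = elems d
    & elementary N (Hset l)].

Definition mostowski_map N (pi : U -> U) :=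
  forall x, N x -> elems (pi x) = pi @` (N `&` elems x).

Definition zero_guessing l N :=
  exists m, [/\ order_type (N `&` elems l) m, is_cardinal m
    & exists2 pi, mostowski_map N pi & pi @` N = Hset m].

(* A coding presents a type T as (the underlying set of) an element of U: the *)
(* point t stands for the element cd t.                                       *)
Record coding (T : Type) := Coding {
  cd :> T -> U;
  cd_inj : injective cd;
  cd_set : exists x, elems x = range cd
}.

Definition graph S T (i : S -> U) (j : T -> U) (f : S -> T) : U :=
  set_of (range (fun s => opair (i s) (j (f s)))).

Definition op_code S T (i : S -> U) (j : T -> U) (op : S -> T -> T) : U :=
  graph (fun st : S * T => opair (i st.1) (j st.2)) j (fun st => op st.1 st.2).

(* the triple (carrier, addition, multiplication) *)
Definition ring_code (R : pzRingType) (cR : coding R) : U :=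
  opair (set_of (range cR)) (opair (op_code cR cR +%R) (op_code cR cR *%R)).

(* the triple (carrier, addition, scalar multiplication) *)
Definition module_code (R : pzRingType) (cR : coding R)
    (M : lmodType R) (cM : coding M) : U :=
  opair (set_of (range cM)) (opair (op_code cM cM +%R) (op_code cR cM *:%R)).

Definition trace T (cT : coding T) N : set T := [set t | N (cT t)].

End SetTheory.

(* The closure proof is an argument of the type so that the algebraic         *)
(* structure can be inferred from it.                                         *)
Section Submodule.
Variables (R : pzRingType) (M : lmodType R) (S : set M).

Record submod (h : submod_closed (mem S)) :=
  Submod { submod_val : M; _ : submod_val \in S }.

Variable h : submod_closed (mem S).

HB.instance Definition _ := [isSub for @submod_val h].
HB.instance Definition _ := [Choice of submod h by <:].
HB.instance Definition _ :=
  GRing.SubChoice_isSubLmodule.Build R M (mem S) (submod h) h.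

End Submodule.

Section Subgroup.
Variables (G : zmodType) (S : set G).

Record subgrp (h : zmod_closed (mem S)) :=
  Subgrp { subgrp_val : G; _ : subgrp_val \in S }.

Variable h : zmod_closed (mem S).

HB.instance Definition _ := [isSub for @subgrp_val h].
HB.instance Definition _ := [Choice of subgrp h by <:].
HB.instance Definition _ :=
  GRing.SubChoice_isSubZmodule.Build G (mem S) (subgrp h) h.

End Subgroup.

Section FreeModule.
Variables (R : pzRingType) (K : choiceType).

Definition finitely_supported : set (K -> R^o) :=
  [set f | finite_set [set k | f k != 0]].

Lemma finitely_supported_submod : submod_closed (mem finitely_supported).
Proof.
split=> [|a f g].
  rewrite inE /finitely_supported /=.
  by have := finite_set0 K; apply: sub_finite_set => k /=; rewrite eqxx.
rewrite !inE /finitely_supported /= => ff gf.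
have fg : finite_set ([set k | f k != 0] `|` [set k | g k != 0]).
  by rewrite finite_setU.
apply: sub_finite_set fg => k.
change (a * f k + g k != 0 -> f k != 0 \/ g k != 0).
have [->|fk _] := eqVneq (f k) 0; last by left.
by rewrite mulr0 add0r; right.
Qed.

Definition freemod : lmodType R := submod finitely_supported_submod.

End FreeModule.

Section Syzygies.
Variable R : pzRingType.
Implicit Types A M : lmodType R.

Definition aug M (f : freemod R M) : M :=
  \sum_(m \in [set: M]) ((val f : M -> R^o) m : R) *: m.

Lemma aug_linear M : linear (@aug M).
Proof.
move=> a f g; pose c (h : freemod R M) m : R := (val h : M -> R^o) m.
have cE m : c (a *: f + g) m = a * c f m + c g m by [].
pose s (h : freemod R M) := [set m | c h m != 0].
have sE (h : freemod R M) (A : {fset M}) : s h `<=` [set` A] ->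
    aug h = \sum_(m <- A) c h m *: m.
  move=> hA; apply: fsbigTE => m mA; change (c h m *: m = 0).
  have [->|hm] := eqVneq (c h m) 0; first by rewrite scale0r.
  by move: mA; rewrite (hA m).
have fs (h : freemod R M) : finite_set (s h) by have := valP h; rewrite inE.
have /finite_fsetP[A AE] : finite_set (s f `|` s g).
  by rewrite finite_setU; split; apply: fs.
have fA : s f `<=` [set` A] by rewrite -AE; left.
have gA : s g `<=` [set` A] by rewrite -AE; right.
have fgA : s (a *: f + g) `<=` [set` A].
  rewrite -AE /s => m; rewrite /= cE.
  have [->|fm _] := eqVneq (c f m) 0; last by left.
  by rewrite mulr0 add0r; right.
rewrite (sE _ _ fA) (sE _ _ gA) (sE _ _ fgA) scaler_sumr -big_split /=.
by apply: eq_bigr => m _; rewrite scalerA -scalerDl cE.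
Qed.

HB.instance Definition _ M :=
  GRing.isLinear.Build R (freemod R M) M *:%R (@aug M) (@aug_linear M).

Definition ker M M' (f : {linear M -> M'}) : set M := [set m | f m = 0].

Lemma ker_submod M M' (f : {linear M -> M'}) : submod_closed (mem (ker f)).
Proof.
split=> [|a m m']; rewrite !inE /ker /= ?linear0 // => fm fm'.
by rewrite linearP fm fm' scaler0 addr0.
Qed.

(* The standard free resolution of A, with syz A n the n-th syzygy:           *)
(*   ... -> freemod (syz A 1) -> freemod (syz A 0) -> A -> 0                  *)
Fixpoint syz (A : lmodType R) (n : nat) : lmodType R :=
  if n is m.+1 then submod (ker_submod (@aug (syz A m))) else A.

Definition bdry A n (f : freemod R (syz A n.+1)) : freemod R (syz A n) :=
  val (aug f).

HB.instance Definition _ A n :=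
  GRing.Linear.copy (@bdry A n)
    ((val : syz A n.+1 -> freemod R (syz A n)) \o (@aug (syz A n.+1))).

Lemma aug_surj M (m : M) : exists f, @aug M f = m.
Proof.
pose d : M -> R^o := fun k => if k == m then 1 else 0.
have ds : d \in @finitely_supported R M.
  rewrite inE; have := finite_set1 m; apply: sub_finite_set => k /=.
  by rewrite /d; have [->//|] := eqVneq k m; rewrite eqxx.
exists (Submod _ ds); rewrite /aug /=.
rewrite (fsbigTE [fset m]%fset) => [|k]; rewrite ?big_seq_fset1 ?inE /d.
  by rewrite eqxx scale1r.
by move=> /negPf ->; rewrite scale0r.
Qed.

Lemma aug_exact A n (f : freemod R (syz A n)) :
  aug f = 0 <-> exists g, @bdry A n g = f.
Proof.
split=> [f0|[g <-]]; last by have := valP (aug g); rewrite inE.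
have fK : f \in ker (@aug (syz A n)) by rewrite inE.
have [g gE] := aug_surj (Submod (ker_submod (@aug (syz A n))) fK).
by exists g; rewrite /bdry gE.
Qed.

Lemma bdry_exact A n (f : freemod R (syz A n.+1)) :
  bdry f = 0 <-> exists g, @bdry A n.+1 g = f.
Proof.
rewrite -aug_exact; split=> [f0|]; first exact: val_inj.
by rewrite /bdry => ->; rewrite raddf0.
Qed.

End Syzygies.

(* The cohomology of the complex                                              *)
(*   Hom(freemod (syz A 0), B) -> Hom(freemod (syz A 1), B) -> ...            *)
Section Ext.
Variables (R : pzRingType) (A B : lmodType R).

Definition is_cocycle n : set (freemod R (syz A n) -> B) :=
  [set f | linear f /\ f \o @bdry R A n = 0].

Definition is_coboundary n : set (freemod R (syz A n) -> B) :=
  if n is m.+1 return set (freemod R (syz A n) -> B) then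
    [set f | exists g : {linear freemod R (syz A m) -> B}, f = g \o @bdry R A m]
  else [set 0].

Lemma cocycle_zmod n : zmod_closed (mem (@is_cocycle n)).
Proof.
split=> [|f g]; rewrite !inE.
  by split=> // a u v; rewrite [RHS]addr0 [LHS]/(0 : B) [RHS]scaler0.
move=> [fl fd] [gl gd]; split=> [a u v|].
  rewrite -[LHS]/(f _ - g _) fl gl.
  rewrite -[RHS]/(a *: (f u - g u) + (f v - g v)).
  by rewrite scalerBr addrACA opprD.
rewrite -[LHS]/((f \o @bdry R A n) - (g \o @bdry R A n)).
by rewrite fd gd subr0.
Qed.

Lemma coboundary_zmod n : zmod_closed (mem (@is_coboundary n)).
Proof.
case: n => [|n]; split=> [|f g]; rewrite !inE //=.
- by move=> -> ->; rewrite subr0.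
- by exists \0.
- by move=> [f' ->] [g' ->]; exists (f' \- g').
Qed.

Definition cocycle n : zmodType := subgrp (@cocycle_zmod n).

Definition coboundary n : {pred cocycle n} :=
  [pred z | val z \in @is_coboundary n].

Lemma coboundary_zmod_closed n : zmod_closed (@coboundary n).
Proof.
by have [c0 cB] := @coboundary_zmod n; split=> // z w; exact: cB.
Qed.

HB.instance Definition _ n :=
  GRing.isZmodClosed.Build (cocycle n) (@coboundary n)
    (@coboundary_zmod_closed n).

Definition Ext n : zmodType := Quotient.quot (@coboundary n).

Definition ext_class n (z : cocycle n) : Ext n :=
  \pi_(Quotient.quot (@coboundary n)) z.

End Ext.

Section ExtTrace.
Variables (U : zfcUniverse) (R : pzRingType) (cR : coding U R).
Variables (A B : lmodType R) (cA : coding U A) (cB : coding U B).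

(* A finitely supported f : K -> R stands for the finite set of all pairs     *)
(* (k, f k) with f k != 0; a syzygy consists of such sets.                    *)
Definition free_code (K : choiceType) (i : K -> U) (f : freemod R K) : U :=
  set_of [set opair (i k) (cR ((val f : K -> R^o) k)) | k in
            [set k | (val f : K -> R^o) k != 0]].

Fixpoint syz_code n : syz A n -> U :=
  if n is m.+1 return syz A n -> U then
    fun x => free_code (@syz_code m) (val x)
  else cA.

Definition cocycle_code n (z : cocycle A B n) : U :=
  graph (free_code (@syz_code n)) cB (val z).

Definition ext_code n (c : Ext A B n) : U :=
  set_of [set cocycle_code z | z in [set z | ext_class z = c]].

(* The classes with a representative in N. For N elementary in Hset l and a   *)
(* class c in Hset l this amounts to N (ext_code c); but classes, unlike      *)
(* cocycles, need not be elements of Hset l.                                  *)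
Definition ext_trace (N : set U) n : set (Ext A B n) :=
  [set ext_class z | z in [set z | N (cocycle_code z)]].

End ExtTrace.

(* Main.v *)
(* Elementarity is used through Tarski-Vaught: whatever is definable in       *)
(* H(lambda) from parameters in N lies in N, and a definable property holds   *)
(* on a set coded in N as soon as it holds at its points in N. Since N is     *)
(* 0-guessing, every subset of N that is covered by some x in N is the trace  *)
(* of an element of N: its image under the Mostowski map is a subset of the   *)
(* image of x, and H(mu) is closed under subsets. Applied to graphs, this     *)
(* extends each function between the traces of S and T to a unique function   *)
(* S -> T in N, which is linear, a cocycle or a coboundary exactly when the   *)
(* given function is. For (i), the free resolution of the trace of A is the   *)
(* trace of that of A: R and all finite sets in N are contained in N, and the *)
(* augmentations are in N, being the unique linear maps with [v] |-> v.       *)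
Require Import Defs.
From HB Require Import structures.
From mathcomp Require Import all_boot all_order all_algebra.
From mathcomp Require Import generic_quotient ring_quotient finmap.
From mathcomp Require Import boolp classical_sets functions cardinality fsbigop.
From Stdlib Require Import Relation_Operators.

Set Implicit Arguments.
Unset Strict Implicit.
Unset Printing Implicit Defensive.

Import GRing.Theory.

Local Open Scope classical_set_scope.
Local Open Scope card_scope.
Local Notation set_of := Defs.set_of.

(** * Cardinal arithmetic *)

(** Two principles carry the proof. Elementarity: whatever is definable in H(lambda) from parameters
    in N lies in N ([mset_term]), and a definable statement holds on a whole sort once it holds at
    the points in N ([internal_all], dually [internal_ex]). Guessing: the collapse of N is some
    H(mu), which is closed under subsets, so a subset of N covered by an element of N is the trace
    of an element of N ([guessing]). The graph of a map between the traces of S and T is such a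
    subset, covered by the product of S and T; hence the map extends to a map from S to T in N
    ([internal_lift]), and to only one ([internal_graph_eq]).

    For (ii), linearity is definable and so passes from a map to its extension ([lifts_linear]);
    every scalar is in N because R has size below kappa and N meets kappa in an ordinal
    ([mset_all]).

    For (i), the standard resolution is built from finite sets of pairs, and a finite set is in N
    exactly when its elements are. So the syzygies of the trace of A are the traces of the syzygies
    of A ([onto_syz]). The augmentations lie in N ([mset_aug]), so being a cocycle and being
    cohomologous are definable and transfer in both directions ([lifts_cocycle], [lifts_cohom]).
    Lifting cocycles thus induces the isomorphism ([ext_iso]). If Ext(A, B) is nonzero, elementarity
    puts a cocycle that is not a coboundary into N, and its restriction is a nonzero class over the
    traces ([ext_zero]).

    Definability is a closure calculus on ambient predicates and terms ([dpred], [dterm]); formulas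
    occur only at its base. The cardinal arithmetic shows that H(lambda) is closed under finite
    subsets ([Hset_finsub]), hence under products, for regular and singular lambda alike. *)

Definition embeds S T (A : set S) (B : set T) := exists f : S -> T,
  (forall x, A x -> B (f x)) /\
  (forall x y, A x -> A y -> f x = f y -> x = y).

Lemma embedsP S T (t : T) (A : set S) (B : set T) :
  A #<= B <-> embeds A B.
Proof.
elim/Ppointed: T => T in t B *; first by case: (no t).
split=> [/pcard_leP[f]|[f [fAB finj]]].
  by exists f; split=> [x|x y Ax Ay]; [exact: funS|apply: inj; rewrite inE].
have /card_eqPle[_ AfA] := inj_card_eq (T := S) (A := A) (f := f)
  ltac:(by move=> x y; rewrite !inE; apply: finj).
by apply: card_le_trans AfA (subset_card_le _) => _ [x Ax <-]; apply: fAB.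
Qed.

Lemma embeds_trans S T V (A : set S) (B : set T) (C : set V) :
  embeds A B -> embeds B C -> embeds A C.
Proof.
move=> [f [fB fi]] [g [gC gi]]; exists (g \o f); split=> [x /fB /gC //|].
by move=> x y Ax Ay /gi /fi; apply=> //; exact: fB.
Qed.

Lemma sub_embeds T (A B : set T) : A `<=` B -> embeds A B.
Proof. by move=> AB; exists id; split. Qed.

(** By Zorn's lemma there is a maximal partial injection from A to B. It is total on A or onto B,
    since otherwise one more pair could be added. *)
Lemma embeds_total S T (s0 : S) (t0 : T) (A : set S) (B : set T) :
  embeds A B \/ embeds B A.
Proof.
pose P (G : set (S * T)) := [/\ G `<=` A `*` B,
  forall s t t', G (s, t) -> G (s, t') -> t = t' &
  forall s s' t, G (s, t) -> G (s', t) -> s = s'].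
have [|G [[GAB Gf Gi] Gmax]] := @Zorn_bigcup _ P.
  move=> F FP tot; have two u v : (\bigcup_(X in F) X) u ->
    (\bigcup_(X in F) X) v -> exists X, [/\ F X, X u & X v].
    move=> [X FX Xu] [Y FY Yv].
    by have [XY|YX] := tot _ _ FX FY; [exists Y|exists X]; split=> //;
       [apply: XY|apply: YX].
  split=> [u [X /FP[XAB _ _] /XAB //]|s t t' u v|s s' t u v].
    by have [X [/FP[_ Xf _] Xu /(Xf _ _ _ Xu)]] := two _ _ u v.
  by have [X [/FP[_ _ Xi] Xu /(Xi _ _ _ Xu)]] := two _ _ u v.
have [Atot|/existsNP[a /not_implyP[Aa aG]]] :=
  pselect (forall a, A a -> exists b, G (a, b)).
  have /choice[f fP] a : exists b, A a -> G (a, b).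
    by have [/Atot[b]|] := pselect (A a); [exists b|exists t0].
  left; exists f; split=> [a /fP /GAB[]//|a a' /fP fa /fP fa' ff].
  by rewrite ff in fa; exact: Gi fa fa'.
have [Btot|/existsNP[b /not_implyP[Bb bG]]] :=
  pselect (forall b, B b -> exists a, G (a, b)).
  have /choice[f fP] b : exists a, B b -> G (a, b).
    by have [/Btot[x]|] := pselect (B b); [exists x|exists s0].
  right; exists f; split=> [x /fP /GAB[]//|x y /fP fa /fP fa' ff].
  by rewrite ff in fa; exact: Gf fa fa'.
exfalso; apply: (Gmax (G `|` [set (a, b)])).
  split=> [u|GG]; first by left.
  by apply: aG; exists b; apply: GG; right.
split=> [u [/GAB //|->]|s t t'|s s' t] //.
- case=> [Gst|[es et]] [Gst'|[es' et']]; subst; first exact: Gf Gst Gst'.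
  + by case: aG; exists t.
  + by case: aG; exists t'.
  + by [].
- case=> [Gst|[es et]] [Gst'|[es' et']]; subst; first exact: Gi Gst Gst'.
  + by case: bG; exists s.
  + by case: bG; exists s'.
  + by [].
Qed.

Lemma finite_set_image T (X : set T) (t : T) : finite_set X ->
  exists n (s : nat -> T), X = s @` `I_n.
Proof.
move=> /finite_setP[n] /card_set_bijP[f [fu fui fus]].
have /choice[g gP] m : exists z, (m < n)%N -> X z /\ f z = m.
  by have [/fus[z zX zm]|] := pselect (m < n)%N; [exists z|exists t].
exists n, g; apply/seteqP; split=> [z zX|_ [m /= /gP[mX _] <-//]].
have zn := fu _ zX; exists (f z) => //; have [gX ge] := gP _ zn.
by apply: fui; rewrite ?inE.
Qed.

(** * The square of an infinite set *)

Section Hessenberg.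
Variables (T : Type) (X : set T).
Hypothesis Xinf : infinite_set X.
Implicit Type G : set ((T * T) * T).

(** A pairing defined on all of the square of Z has Z as the domain of its diagonal, so the graph
    alone can be the datum handed to Zorn's lemma. *)
Let fld G : set T := [set x | exists z, G ((x, x), z)].

Let good G := [/\ forall p z z', G (p, z) -> G (p, z') -> z = z',
  forall p p' z, G (p, z) -> G (p', z) -> p = p',
  forall x y z, G ((x, y), z) -> [/\ fld G x, fld G y & fld G z],
  forall x y, fld G x -> fld G y -> exists z, G ((x, y), z) &
  fld G `<=` X].

Let good_bigcup F : F `<=` good -> total_on F subset ->
  good (\bigcup_(G in F) G).
Proof.
move=> Fg tot.
have two u v : (\bigcup_(G in F) G) u -> (\bigcup_(G in F) G) v ->
    exists G, [/\ F G, G u & G v].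
  move=> [G FG Gu] [G' FG' Gv].
  by have [XY|YX] := tot _ _ FG FG'; [exists G'|exists G]; split=> //;
     [apply: XY|apply: YX].
split=> [p z z' u v|p p' z u v|x y z [G FG Gu]|x y [z u] [z' v]|x [z [G FG u]]].
- by have [G [/Fg[h _ _ _ _] Gu Gv]] := two _ _ u v; apply: h Gu Gv.
- by have [G [/Fg[_ h _ _ _] Gu Gv]] := two _ _ u v; apply: h Gu Gv.
- have /Fg[_ _ h _ _] := FG; have [[a ?] [b ?] [c ?]] := h _ _ _ Gu.
  by split; [exists a|exists b|exists c]; exists G.
- have [G [FG Gu Gv]] := two _ _ u v.
  have /Fg[_ _ _ h _] := FG.
  have [w Gw] := h x y (ex_intro _ _ Gu) (ex_intro _ _ Gv).
  by exists w, G.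
- by have /Fg[_ _ _ _ h] := FG; apply: h; exists z.
Qed.

(** Take a maximal injection of a square of Z into Z, for Z contained in X. Either the complement of
    Z embeds in Z, and then so does X, or it contains a copy of Z, and then the injection extends to
    the union of Z and this copy. *)
Theorem Hessenberg : exists f : T -> T -> T,
  (forall x y, X x -> X y -> X (f x y)) /\
  (forall x y x' y', X x -> X y -> X x' -> X y' -> f x y = f x' y' ->
    x = x' /\ y = y').
Proof.
have [x0 Xx0] := infinite_setN0 Xinf.
have [i [iX iinj]] : embeds [set: nat] X.
  by apply/(embedsP x0); apply/infiniteP.
have {}iX n : X (i n) by apply: iX.
have {}iinj m n : i m = i n -> m = n by apply: iinj.
(* The pairing of the natural numbers, carried to a countable subset of X. Starting from it puts the
   tags [i n] into Z. *)
pose G0 : set ((T * T) * T) := range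
  (fun mn : nat * nat => ((i mn.1, i mn.2), i (choice.pickle mn))).
have fld0 : fld G0 = range i.
  apply/seteqP; split=> [x [z [[m n] _ [<- _ _]]]|_ [n _ <-]]; first by exists m.
  by exists (i (choice.pickle (n, n))), (n, n).
have good0 : good G0.
  split.
  - move=> p z z' [[m n] _ [<- <-]] [[m' n'] _ [] ].
    by move=> /iinj -> /iinj -> ->.
  - move=> p p' z [[m n] _ [<- <-]] [[m' n'] _ [<- /iinj]].
    by move=> /(pcan_inj choice.pickleK)[-> ->].
  - move=> x y z [[m n] _ [<- <- <-]].
    by rewrite fld0; split; [exists m|exists n|exists (choice.pickle (m, n))].
  - rewrite fld0 => _ _ [m _ <-] [n _ <-].
    by exists (i (choice.pickle (m, n))), (m, n).
  - by rewrite fld0 => _ [n _ <-].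
(* The empty chain has union [set0], which must belong to the family; hence the first disjunct. *)
have [|G [GP Gmax]] := @Zorn_bigcup _ [set G | G = set0 \/ G0 `<=` G /\ good G].
  move=> F FP tot; pose F' := F `&` [set G | G0 `<=` G].
  have F'E : \bigcup_(G in F) G = \bigcup_(G in F') G.
    apply/seteqP; split=> [u [G FG Gu]|u [G [FG _] Gu]]; last by exists G.
    exists G => //; split=> //; case: (FP _ FG) => [G0E|[]//].
    by rewrite G0E in Gu.
  have [[G [FG G0G]]|F'0] := pselect (exists G, F' G); last first.
    left; rewrite F'E; apply/seteqP; split=> // u [G F'G _].
    by apply: F'0; exists G.
  right; split.
    by move=> u /G0G Gu; exists G.
  rewrite F'E; apply: good_bigcup => [H [/FP[->|[//]] H0]|H H' [FH _] [FH' _]].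
    by have := H0 ((i 0, i 0), i (choice.pickle (0, 0))); case; exists (0, 0).
  exact: tot.
have G0G : G0 `<=` G.
  case: GP => [GE|[]//]; subst G; suff /Gmax[] : set0 `<` G0 by right; split.
  by split=> // h; apply: (h ((i 0, i 0), i (choice.pickle (0, 0)))); exists (0, 0).
have {GP} [Gf Gi Gfld Gt GX] : good G.
  case: GP => [GE|[]//]; subst G.
  by case: (G0G ((i 0, i 0), i (choice.pickle (0, 0)))); exists (0, 0).
have Zi n : fld G (i n).
  by exists (i (choice.pickle (n, n))); apply: G0G; exists (n, n).
have /choice[f2 f2P] p : exists z, fld G p.1 -> fld G p.2 -> G (p, z).
  case: p => x y /=; have [[Zx Zy]|nZ] := pselect (fld G x /\ fld G y).
    by have [z] := Gt _ _ Zx Zy; exists z.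
  by exists x => Zx Zy; case: nZ.
pose f x y := f2 (x, y).
have fG x y : fld G x -> fld G y -> G ((x, y), f x y) by apply: (f2P (x, y)).
have fZ x y : fld G x -> fld G y -> fld G (f x y).
  by move=> Zx Zy; have [] := Gfld _ _ _ (fG _ _ Zx Zy).
have finj x y x' y' : fld G x -> fld G y -> fld G x' -> fld G y' ->
    f x y = f x' y' -> x = x' /\ y = y'.
  move=> Zx Zy Zx' Zy' ff; have := fG _ _ Zx Zy; rewrite ff.
  by move=> /(Gi _ _ _ (fG _ _ Zx' Zy'))[-> ->].
have [[g [gX ginj]]|[g [gX ginj]]] :=
    embeds_total x0 x0 (fld G) (X `\` fld G); last first.
  (* X embeds in two copies of Z, tagged by [i 0] and [i 1], and hence in Z. *)
  pose h x := if pselect (fld G x) then f x (i 0) else f (g x) (i 1).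
  have hZ x : X x -> fld G (h x).
    by move=> Xx; rewrite /h; case: pselect => Zx; apply: fZ => //; apply: gX.
  have hinj x y : X x -> X y -> h x = h y -> x = y.
    move=> Xx Xy; rewrite /h; case: pselect => Zx; case: pselect => Zy e.
    - by have [] := finj _ _ _ _ Zx (Zi _) Zy (Zi _) e.
    - have [_ /iinj //] := finj _ _ _ _ Zx (Zi _) (gX _ (conj Xy Zy)) (Zi _) e.
    - have [_ /iinj //] := finj _ _ _ _ (gX _ (conj Xx Zx)) (Zi _) Zy (Zi _) e.
    - have [gg _] :=
        finj _ _ _ _ (gX _ (conj Xx Zx)) (Zi _) (gX _ (conj Xy Zy)) (Zi _) e.
      exact: ginj gg.
  exists (fun x y => f (h x) (h y)); split=> [x y Xx Xy|x y x' y' Xx Xy Xx' Xy'].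
    by apply: GX; apply: fZ; apply: hZ.
  move=> /(finj _ _ _ _ (hZ _ Xx) (hZ _ Xy) (hZ _ Xx') (hZ _ Xy'))[].
  by split; apply: hinj.
(* The square of Z and its copy g Z, minus the square of Z, is three copies   *)
(* of the square of Z, so it embeds into g Z.                                 *)
exfalso; pose Z' := g @` fld G.
have gZ x : fld G x -> ~ fld G (g x) by move=> /gX[].
pose c n x y := g (f (f x y) (i n)).
have cinj m n x y x' y' : fld G x -> fld G y -> fld G x' -> fld G y' ->
    c m x y = c n x' y' -> [/\ m = n, x = x' & y = y'].
  move=> Zx Zy Zx' Zy' /ginj e.
  have {e}[] := finj _ _ _ _ (fZ _ _ Zx Zy) (Zi _) (fZ _ _ Zx' Zy') (Zi _)
    (e (fZ _ _ (fZ _ _ Zx Zy) (Zi _)) (fZ _ _ (fZ _ _ Zx' Zy') (Zi _))).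
  by move=> /finj[] // -> -> /iinj ->.
have cZ' n x y : fld G x -> fld G y -> Z' (c n x y).
  by move=> Zx Zy; exists (f (f x y) (i n)) => //; do 2?apply: (fZ).
have Z'G x : Z' x -> ~ fld G x by move=> [y Zy <-]; apply: gZ.
pose D : set ((T * T) * T) := [set u | exists x y, [/\ fld G x, fld G y &
  u = ((g x, y), c 0 x y) \/ u = ((x, g y), c 1 x y) \/
  u = ((g x, g y), c 2 x y)]].
have Dz p z : D (p, z) -> ~ fld G z.
  by move=> [x [y [Zx Zy []]]];
    [|case] => -[_ ->]; apply: Z'G; apply: cZ'.
have Dp x y z : D ((x, y), z) -> ~ (fld G x /\ fld G y).
  by move=> [a [b [Za Zb []]]]; [|case] => -[-> -> _] [h1 h2];
    [apply: gZ h1|apply: gZ h2|apply: gZ h1].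
have ZG x y z : G ((x, y), z) -> [/\ fld G x, fld G y & fld G z] := Gfld x y z.
have fldD : fld (G `|` D) = fld G `|` Z'.
  apply/seteqP; split=> [x [z [Gz|[a [b [Za Zb]]]]]|x [[z Gz]|[y Zy <-]]].
  - by left; exists z.
  - by case=> [|[]] [] ? ? ?; subst; [left|left|right; exists a].
  - by exists z; left.
  - by exists (c 2 y y); right; exists y, y; split=> //; right; right.
apply: (Gmax (G `|` D)).
  split=> [u Gu|h]; first by left.
  have := gZ _ (Zi 0); apply.
  exists (c 2 (i 0) (i 0)); apply: h; right; exists (i 0), (i 0).
  by split=> //; right; right.
right; split; first by move=> u /G0G; left.
split.
- move=> [a b] z z' [Gz|Dzz] [Gz'|Dz'].
  + exact: Gf Gz Gz'.
  + by have [? ? _] := ZG _ _ _ Gz; case: (Dp _ _ _ Dz').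
  + by have [? ? _] := ZG _ _ _ Gz'; case: (Dp _ _ _ Dzz).
  + case: Dzz Dz' => [x [y [Zx Zy e]]] [x' [y' [Zx' Zy' e']]].
    case: e => [|[]] [? ? ?]; case: e' => [|[]] [e1 e2 ?]; subst;
      try (by case: (gZ _ Zx)); try (by case: (gZ _ Zy));
      try (by case: (gZ _ Zx')); try (by case: (gZ _ Zy'));
      try (by case: (gZ _ Zx); rewrite e1); try (by case: (gZ _ Zy); rewrite e2);
      try (by case: (gZ _ Zx'); rewrite -e1);
      try (by case: (gZ _ Zy'); rewrite -e2); 
      try (move/ginj: e1 => ->//); try (move/ginj: e2 => -> //).
- move=> [a b] [a' b'] z [Gz|Dzz] [Gz'|Dz'].
  + exact: Gi Gz Gz'.
  + by have [_ _ ?] := ZG _ _ _ Gz; case: (Dz _ _ Dz').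
  + by have [_ _ ?] := ZG _ _ _ Gz'; case: (Dz _ _ Dzz).
  + case: Dzz Dz' => [x [y [Zx Zy e]]] [x' [y' [Zx' Zy' e']]].
    by case: e => [|[]] [? ? ?]; case: e' => [|[]] [? ? e3]; subst;
      have [] := cinj _ _ _ _ _ _ Zx Zy Zx' Zy' e3 => // _ -> ->.
- move=> x y z; rewrite fldD => -[/ZG[]|]; first by split; left.
  move=> [a [b [Za Zb []]]]; [|case] => -[-> -> ->];
    split; by [left|right; exists a|right; exists b|right; apply: cZ'].
- rewrite fldD => x y [Zx|[a Za <-]] [Zy|[b Zb <-]].
  + by have [z] := Gt _ _ Zx Zy; exists z; left.
  + by exists (c 1 x b); right; exists x, b; split=> //; right; left.
  + by exists (c 0 a y); right; exists a, y; split=> //; left.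
  + by exists (c 2 a b); right; exists a, b; split=> //; right; right.
- by rewrite fldD => x [/GX//|[a /gX[Xa _] <-]].
Qed.

End Hessenberg.

(** * Ordinals and hereditarily small sets *)

Section SetTheory.
Variable U : zfcUniverse.
Implicit Types (x y z a b d k u v w : U) (P X Y Z : set U).

Definition is_set P := exists x, elems x = P.

Lemma elemsE x y : (y ∈ x) = elems x y. Proof. by []. Qed.

Lemma elems_inj x y : elems x = elems y -> x = y.
Proof.
move=> xy; apply: zfc_extensionality => z.
by have : elems x z <-> elems y z by rewrite xy.
Qed.

Lemma set_ofE P : is_set P -> elems (set_of P) = P.
Proof.
by rewrite /set_of => h; case: pselect => // h'; case: (cid h').
Qed.

Lemma elems_set_of x : set_of (elems x) = x.
Proof. by apply: elems_inj; apply: set_ofE; exists x. Qed.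

Lemma is_set_sub x P : P `<=` elems x -> is_set P.
Proof.
move=> Px; have [s sP] := zfc_separation P x; exists s.
by apply/seteqP; split=> z; [move/sP=> []|move=> Pz; apply/sP; split; [exact: Px|]].
Qed.

Lemma is_set_image (f : U -> U) x : is_set (f @` elems x).
Proof.
have [y z z' _ <- <- //|s sP] := @zfc_replacement U (fun y z => f y = z) x.
exists s; apply/seteqP; split=> z; first by move/sP=> [y [? <-]]; exists y.
by move=> [y yx <-]; apply/sP; exists y.
Qed.

Lemma is_set2 x y : is_set [set x; y].
Proof.
have [p pP] := zfc_pairing x y; exists p.
by apply/seteqP; split=> z /pP.
Qed.

Lemma is_set1 x : is_set [set x].
Proof. by have := is_set2 x x; rewrite setUid. Qed.

Lemma is_setU P Q : is_set P -> is_set Q -> is_set (P `|` Q).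
Proof.
move=> [p pE] [q qE]; have [r rE] := is_set2 p q.
have [u uP] := zfc_union r; exists u; apply/seteqP; split=> z.
  move=> /uP[y []]; rewrite elemsE rE -pE -qE.
  by case=> -> ?; [left|right].
by rewrite -pE -qE => -[zp|zq]; apply/uP; [exists p|exists q];
  rewrite elemsE rE; split=> //; [left|right].
Qed.

Lemma is_set0 : is_set set0.
Proof. by apply: (@is_set_sub (set_of set0)). Qed.

Lemma elems_set1 x : elems (set_of [set x]) = [set x].
Proof. exact/set_ofE/is_set1. Qed.

Lemma elems_set2 x y : elems (set_of [set x; y]) = [set x; y].
Proof. exact/set_ofE/is_set2. Qed.

Lemma elems_opair x y :
  elems (opair x y) = [set set_of [set x]; set_of [set x; y]].
Proof. exact: elems_set2. Qed.

Lemma opair_inj x y x' y' : opair x y = opair x' y' -> x = x' /\ y = y'.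
Proof.
move=> e; have E : [set set_of [set x]; set_of [set x; y]] =
    [set set_of [set x']; set_of [set x'; y']].
  by rewrite -!elems_opair e.
have F11 u v : set_of [set u] = set_of [set v] -> u = v.
  move=> h; have : elems (set_of [set u]) u by rewrite elems_set1.
  by rewrite h elems_set1.
have F12 u v w : set_of [set u] = set_of [set v; w] -> u = v /\ u = w.
  move=> h; have {}h : elems (set_of [set u]) = elems (set_of [set v; w]).
    by rewrite h.
  rewrite elems_set1 elems_set2 in h; move/seteqP: h => [_ h].
  by split; apply/esym/h; [left|right].
have F22 u v w : set_of [set u; v] = set_of [set u; w] -> v = w.
  move=> h; have {}h : elems (set_of [set u; v]) = elems (set_of [set u; w]).
    by rewrite h.
  rewrite !elems_set2 in h; move/seteqP: h => [h h'].
  have [vu|->//] := h v (or_intror erefl); have [wu|->//] := h' w (or_intror erefl).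
  by rewrite vu wu.
move/seteqP: E => [E E'].
have xx : x = x'.
  by have [/F11|/F12[]] := E _ (or_introl erefl).
subst x'; split=> //.
have [/esym/F12[_ xy]|/F22//] := E _ (or_intror erefl).
have [/esym/F12[_ xy']|/F22//] := E' _ (or_intror erefl).
by rewrite -xy -xy'.
Qed.

Lemma zin_irrefl x : ~ x ∈ x.
Proof.
have [s sE] := is_set1 x.
have [|y []] := @zfc_foundation U s; first by exists x; rewrite elemsE sE.
rewrite elemsE sE => -> h; apply: h.
by rewrite elemsE sE.
Qed.

Lemma ord_mem a b : is_ordinal a -> b ∈ a -> is_ordinal b.
Proof.
move=> [at_ ae] ba; split; first exact: ae.
by move=> y yb; apply: ae; apply: at_ yb.
Qed.

Lemma ord_min a P : is_ordinal a -> (exists x, x ∈ a /\ P x) ->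
  exists x, [/\ x ∈ a, P x & forall y, y ∈ x -> ~ P y].
Proof.
move=> [aT _] [x [xa Px]]; have [s sE] := @is_set_sub a (elems a `&` P)
  ltac:(by move=> z []).
have sP z : z ∈ s <-> z ∈ a /\ P z by rewrite elemsE sE.
have [|y [/sP[ya Py] ymin]] := @zfc_foundation U s.
  by exists x; apply/sP.
by exists y; split=> // z zy Pz; apply: (ymin z) => //; apply/sP; split=> //;
  apply: aT zy.
Qed.

Lemma ord_ind a P : is_ordinal a ->
  (forall x, x ∈ a -> (forall y, y ∈ x -> P y) -> P x) ->
  forall x, x ∈ a -> P x.
Proof.
move=> aO IH x xa; apply: contrapT => nPx.
have [|y [ya nPy ymin]] := @ord_min a (~` P) aO; first by exists x.
by apply: nPy; apply: IH => // z /ymin /contrapT.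
Qed.

Lemma ord_total_mem a x y : is_ordinal a -> x ∈ a -> y ∈ a ->
  [\/ x ∈ y, x = y | y ∈ x].
Proof.
move=> aO; pose C x y := [\/ x ∈ y, x = y | y ∈ x].
have [aT ae] := aO; rewrite -/(C x y) => xa; move: x xa y.
apply: ord_ind => // x xa IHx; apply: ord_ind => // y ya IHy.
have [xy|nxy] := pselect (x ∈ y); first exact: Or31.
have [yx|nyx] := pselect (y ∈ x); first exact: Or33.
apply: Or32; apply: elems_inj; apply/seteqP; split=> z zx.
  have [//|zy|yz] := IHx z zx y ya; first by rewrite zy in zx.
  by case: nyx; apply: (ae x) yz.
have [xz|xz|//] := IHy z zx; last by rewrite -xz in zx.
by case: nxy; apply: (ae y) xz.
Qed.

(** If b is not all of a, then b is the least element of a outside b. *)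
Lemma ord_sub a b : is_ordinal a -> is_ordinal b -> elems b `<=` elems a ->
  b = a \/ b ∈ a.
Proof.
move=> aO [bT be] ba; have [aT _] := aO.
have [h|h] := pselect (exists x, x ∈ a /\ ~ x ∈ b).
  have [c [ca cb cmin]] := ord_min aO h.
  right; suff -> : b = c by [].
  apply: elems_inj; apply/seteqP; split=> z zb; last by apply: contrapT; apply: cmin.
  have [//|zc|cz] := ord_total_mem aO (ba _ zb) ca.
    by case: cb; rewrite -zc.
  by case: cb; apply: bT cz.
left; apply: elems_inj; apply/seteqP; split=> // z za.
by apply: contrapT => zb; apply: h; exists z.
Qed.

(** The intersection d is an ordinal. By [ord_sub], unless it equals a or b, it is an element of
    both, so d would belong to d. *)
Lemma ord_total a b : is_ordinal a -> is_ordinal b ->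
  elems a `<=` elems b \/ elems b `<=` elems a.
Proof.
move=> aO bO; have [d dE] := @is_set_sub a (elems a `&` elems b)
  ltac:(by move=> z []).
have dP z : z ∈ d <-> z ∈ a /\ z ∈ b by rewrite elemsE dE.
have [aT ae] := aO; have [bT be] := bO.
have dO : is_ordinal d.
  split=> [x y /dP[xa xb] yx|x /dP[xa xb]]; last exact: ae.
  by apply/dP; split; [apply: aT yx|apply: bT yx].
have [da|da] := ord_sub aO dO (fun z h => ((dP z).1 h).1).
  by left=> z za; have /dP[] : z ∈ d by rewrite da.
have [db|db] := ord_sub bO dO (fun z h => ((dP z).1 h).2).
  by right=> z zb; have /dP[] : z ∈ d by rewrite db.
by case: (@zin_irrefl d); apply/dP.
Qed.

(** The Mostowski collapse c of Z, defined by recursion along a. Since c x never exceeds x, the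
    image is an ordinal at most a. *)
Lemma ord_collapse a Z : is_ordinal a -> Z `<=` elems a ->
  exists b, [/\ is_ordinal b, b = a \/ b ∈ a & elems b #= Z].
Proof.
move=> aO Za; have [aT ae] := aO.
have wf : well_founded (fun y x => y ∈ x /\ x ∈ a).
  move=> x; have [xa|xa] := pselect (x ∈ a); last by split=> y [].
  by move: x xa; apply: (ord_ind aO) => x xa IH; split=> y [/IH].
pose F x (c : forall y, y ∈ x /\ x ∈ a -> U) : U :=
  set_of [set u | exists y (h : y ∈ x /\ x ∈ a), Z y /\ u = c y h].
pose c := Fix wf (fun=> U) F.
have cE x : x ∈ a -> elems (c x) = c @` (elems x `&` Z).
  move=> xa; rewrite /c Fix_eq; last first.
    move=> x' f g fg; congr set_of; apply/seteqP.
    by split=> u [y [h [Zy ->]]]; exists y, h; rewrite fg.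
  rewrite set_ofE; first last.
    have [s sE] := is_set_image c x; apply: (@is_set_sub s).
    by rewrite sE => u [y [[yx _] [_ ->]]]; exists y.
  apply/seteqP; split=> u; first by move=> [y [[yx _] [Zy ->]]]; exists y.
  by move=> [y [yx Zy] <-]; exists y; exists (conj yx xa).
have cT x : x ∈ a -> is_transitive (elems (c x)).
  move=> xa u v; rewrite cE // => -[y [yx Zy] <-].
  rewrite elemsE cE; last exact: aT yx.
  move=> [z [zy Zz] <-].
  by exists z => //; split=> //; apply: (ae x) zy.
have cO x : x ∈ a -> is_ordinal (c x).
  move=> xa; split; first exact: cT.
  move=> u; rewrite elemsE cE // => -[y [yx _] <-]; apply: cT.
  exact: aT yx.
have cle x : x ∈ a -> c x = x \/ c x ∈ x.
  move: x; apply: (ord_ind aO) => x xa IH; apply: ord_sub; [exact: ord_mem xa|exact: cO|].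
  move=> u; rewrite cE // => -[y [yx _] <-].
  by have [->//|cy] := IH y yx; apply: (ae x) cy.
have [b bE] : is_set (c @` Z).
  have [s sE] := is_set_image c a; apply: (@is_set_sub s).
  by rewrite sE; apply: image_subset.
have bO : is_ordinal b.
  split=> [u v|u]; rewrite ?bE.
    move=> [x Zx <-]; rewrite elemsE cE; last exact: Za.
    by move=> [y [_ Zy] <-]; exists y.
  by rewrite elemsE bE => -[x Zx <-]; apply/cT/Za.
exists b; split=> //.
  apply: ord_sub => // u; rewrite bE => -[x /Za xa <-].
  by have [->//|cx] := cle x xa; apply: aT cx.
rewrite bE; apply: inj_card_eq => x y; rewrite !inE => Zx Zy cxy.
have cin u v : Z u -> Z v -> u ∈ v -> c u ∈ c v.
  by move=> Zu Zv uv; rewrite elemsE cE; [exists u|exact: Za].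
have [xy|//|yx] := ord_total_mem aO (Za _ Zx) (Za _ Zy).
  by have := cin _ _ Zx Zy xy; rewrite cxy => /zin_irrefl.
by have := cin _ _ Zy Zx yx; rewrite cxy => /zin_irrefl.
Qed.

(** [card_lt] asks for a bijection with an element of k. The collapse of the image of X in a
    provides one, so from here on embeddings suffice. *)
Lemma embeds_card_lt T (X : set T) k a : is_ordinal k -> a ∈ k ->
  embeds X (elems a) -> card_lt X k.
Proof.
move=> kO ak [f [fa fi]]; have [|b [_ ba bX]] :=
  @ord_collapse a (f @` X) (ord_mem kO ak); first by move=> _ [x /fa ? <-].
exists b; split; first by case: ba => [->//|]; apply: (kO.1) ak.
apply: card_esym; apply: card_eq_trans bX _; apply: inj_card_eq => x y.
by rewrite !inE; apply: fi.
Qed.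

Lemma card_lt_embeds T (X : set T) k : card_lt X k ->
  exists a, a ∈ k /\ embeds X (elems a).
Proof.
move=> [a [ak Xa]]; exists a; split=> //; apply/(embedsP a).
by have /card_eqPle[] := Xa.
Qed.

Lemma trcl_sub x (T : set U) : elems x `<=` T -> is_transitive T -> trcl x `<=` T.
Proof.
move=> xT TT y; rewrite /trcl /=; move: xT => + xy; elim: xy => {x y}.
  by move=> y x yx; apply.
move=> z y x zy IHzy yx IHyx xT; apply: IHzy => u uy.
by apply: TT uy; apply: IHyx.
Qed.

Lemma trcl_elems x : elems x `<=` trcl x.
Proof. by move=> y yx; apply: t_step. Qed.

Lemma trcl_transitive x : is_transitive (trcl x).
Proof. by move=> y z yx zy; apply: t_trans yx; apply: t_step. Qed.

Lemma trcl_mono x y : elems x `<=` elems y -> trcl x `<=` trcl y.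
Proof.
move=> xy; apply: trcl_sub (@trcl_transitive y).
exact: subset_trans xy (@trcl_elems y).
Qed.

Lemma trcl_mem x y : y ∈ x -> trcl y `<=` trcl x.
Proof.
move=> yx; apply: trcl_sub (@trcl_transitive x) => z zy.
by apply: trcl_transitive zy; apply: trcl_elems.
Qed.

Lemma ord_trcl a : is_ordinal a -> trcl a `<=` elems a.
Proof. by move=> [aT _]; apply: trcl_sub. Qed.

Definition finsub X : set U := [set u | finite_set (elems u) /\ elems u `<=` X].

Lemma is_set_powerset x P : (forall y, P y -> elems y `<=` elems x) -> is_set P.
Proof.
have [p pP] := zfc_powerset x; move=> Px; apply: (@is_set_sub p) => y Py.
by apply/pP => z; apply: (Px _ Py).
Qed.

Lemma Hset_transitive k : is_ordinal k -> is_transitive (Hset k).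
Proof.
move=> kO x y /card_lt_embeds[a [ak xa]] yx; apply: embeds_card_lt kO ak _.
by apply: embeds_trans xa; apply/sub_embeds/trcl_mem.
Qed.

Lemma Hset_sub k x y : is_ordinal k -> Hset k x -> elems y `<=` elems x ->
  Hset k y.
Proof.
move=> kO /card_lt_embeds[a [ak xa]] yx; apply: embeds_card_lt kO ak _.
by apply: embeds_trans xa; apply/sub_embeds/trcl_mono.
Qed.

Lemma Hset_ord k a : is_ordinal k -> a ∈ k -> Hset k a.
Proof.
move=> kO ak; apply: (embeds_card_lt kO ak).
exact/sub_embeds/ord_trcl/(ord_mem kO ak).
Qed.

Lemma is_set_embeds X a : embeds X (elems a) -> is_set X.
Proof.
move=> [f [fa fi]].
have /choice[g gP] y : exists z, forall u, X u -> f u = y -> u = z.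
  have [[z [Xz <-]]|h] := pselect (exists z, X z /\ f z = y).
    by exists z => u Xu /fi; apply.
  by exists a => u Xu fu; case: h; exists u.
have [s sE] := is_set_image g a; apply: (@is_set_sub s) => u Xu.
by rewrite sE; exists (f u); [exact: fa|apply/esym/gP].
Qed.

(** Foundation yields minimal elements of sets only. The transitive closure of x is a set because it
    embeds in an ordinal, and the minimal counterexample is taken there. *)
Lemma Hset_ind k P : is_ordinal k ->
  (forall x, Hset k x -> (forall y, y ∈ x -> P y) -> P x) ->
  forall x, Hset k x -> P x.
Proof.
move=> kO IH x Hx; have [t tE] : is_set (trcl x).
  by have /card_lt_embeds[a [_]] := Hx; apply: is_set_embeds.
have Ht y : y ∈ t -> Hset k y.
  rewrite elemsE tE => ty; have /card_lt_embeds[a [ak ta]] := Hx.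
  apply: (embeds_card_lt kO ak); apply: embeds_trans ta.
  apply: sub_embeds; apply: trcl_sub; last exact: trcl_transitive.
  by move=> z zy; apply: trcl_transitive zy.
apply: (IH) => // y /trcl_elems; rewrite -tE => yt.
have [s sE] := @is_set_sub t (elems t `&` ~` P) ltac:(by move=> z []).
apply: contrapT => nPy; have ys : y ∈ s by rewrite elemsE sE.
have [z [zs zmin]] := zfc_foundation (ex_intro _ y ys).
rewrite elemsE sE in zs; case: zs => zt; apply; apply: IH; first exact: Ht.
move=> u uz; apply: contrapT => nPu; apply: (zmin u) => //.
rewrite elemsE sE; split=> //; rewrite tE; apply: trcl_transitive uz.
by rewrite -tE.
Qed.

End SetTheory.

(** * Closure properties of H(lambda) *)

Section Hereditary.
Variables (U : zfcUniverse) (k : U).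
Hypotheses (kO : is_ordinal k) (kN : ~ countable (elems k)).
Implicit Types (x y z a b d u v w : U) (P X Y Z : set U).
Notation H := (Hset k).

(** Otherwise every element of k is finite, and sending it to its size injects k into the natural
    numbers. *)
Lemma infinite_ordinal : exists a, a ∈ k /\ infinite_set (elems a).
Proof.
apply: contrapT => h; apply: kN; apply/(embedsP 0%N).
have /choice[n nP] a : exists n : nat, a ∈ k -> elems a #= `I_n.
  have [ak|] := pselect (a ∈ k); last by exists 0%N.
  have /finite_setP[n an] : finite_set (elems a).
    by apply: contrapT => ainf; apply: h; exists a.
  by exists n.
exists n; split=> // a b ak bk nab.
have lt x y : x ∈ k -> y ∈ k -> n x = n y -> ~ x ∈ y.
  move=> xk yk nxy xy; have [yT _] := ord_mem kO yk.
  suff : `I_(n y).+1 #<= `I_(n y) by rewrite card_le_II ltnn.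
  have /card_eqPle[yn _] := nP _ yk; apply: card_le_trans yn.
  have /card_esym/card_eqPle[/(embedsP x)[f [fx fi]] _] := nP _ xk.
  (* The indices below [n x] enumerate x and the index [n x] goes to x itself, so y has more than
     [n x] elements. *)
  apply/(embedsP x); exists (fun m => if m == n x then x else f m).
  rewrite -nxy; split=> [m|m m'] /=; rewrite ltnS leq_eqVlt.
    by have [_ _|mn /= /fx/(yT _ _ xy)] := eqVneq m (n x).
  rewrite [X in _ -> is_true X -> _]ltnS [X in _ -> is_true X -> _]leq_eqVlt.
  have [-> _|mn /= lt] := eqVneq m; have [-> _ //|mn' /= lt'] := eqVneq m'.
  - by move=> xE; have := fx _ lt'; rewrite -xE => /zin_irrefl.
  - by move=> xE; have := fx _ lt; rewrite xE => /zin_irrefl.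
  - exact: fi.
have [ab|//|ba] := ord_total_mem kO ak bk; first by case: (lt a b).
by case: (lt b a).
Qed.

(** The bound is required to be infinite so that [Hessenberg] applies to it. *)
Definition small T (X : set T) :=
  exists a, [/\ a ∈ k, infinite_set (elems a) & embeds X (elems a)].

Lemma smallP T (X : set T) : small X <-> card_lt X k.
Proof.
split=> [[a [ak _ Xa]]|]; first exact: embeds_card_lt Xa.
move=> /card_lt_embeds[a [ak Xa]]; have [w [wk winf]] := infinite_ordinal.
have [aw|wa] := ord_total (ord_mem kO ak) (ord_mem kO wk).
  by exists w; split=> //; apply: embeds_trans Xa (sub_embeds aw).
exists a; split=> // /(sub_finite_set wa); exact: winf.
Qed.

Lemma small_embeds S T (X : set S) (Y : set T) : embeds X Y -> small Y -> small X.
Proof.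
by move=> XY [a [ak ainf Ya]]; exists a; split=> //; apply: embeds_trans Ya.
Qed.

Lemma smallU T (X Y : set T) : small X -> small Y -> small (X `|` Y).
Proof.
have wlog a b : a ∈ k -> infinite_set (elems a) -> embeds X (elems a) ->
    embeds Y (elems a) -> small (X `|` Y).
  move=> ak ainf [f [fa fi]] [g [ga gi]]; exists a; split=> //.
  have [p [pa pi]] := Hessenberg ainf.
  have /infiniteP/(embedsP a)[i [ia ii]] := ainf.
  have {}ia n : i n ∈ a by apply: ia.
  have i01 : i 0%N <> i 1%N by move=> /ii e; have := e I I.
  pose h (t : T) := if pselect (X t) then f t else g t.
  pose tag (t : T) := i (if pselect (X t) then 0%N else 1%N).
  have ha t : (X `|` Y) t -> h t ∈ a.
    by rewrite /h; case: pselect => [/fa //|nXx [//|/ga]].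
  exists (fun t => p (h t) (tag t)); split=> [t XYt|s t XYs XYt].
    by apply: pa; [apply: ha|apply: ia].
  move=> /pi[||||]; rewrite -?elemsE; try exact: ha; try exact: ia.
  move: XYs XYt; rewrite /h /tag.
  case: pselect => Xs; case: pselect => Xt; rewrite /setU /= => Ys Yt e e'.
  - exact: fi.
  - by case: i01.
  - by case: i01.
  - by case: Ys Yt => // ? []// ?; apply: gi.
move=> [a [ak ainf Xa]] [b [bk binf Yb]].
have [ab|ba] := ord_total (ord_mem kO ak) (ord_mem kO bk).
  by apply: (wlog b) => //; apply: embeds_trans Xa (sub_embeds ab).
by apply: (wlog a) => //; apply: embeds_trans Yb (sub_embeds ba).
Qed.

Lemma small1 T (x : T) : small [set x].
Proof.
have [w [wk winf]] := infinite_ordinal; exists w; split=> //.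
have [z zw] := infinite_setN0 winf.
by exists (fun=> z); split=> // u v -> ->.
Qed.

(** A finite subset is enumerated by a sequence, which iterated pairing folds into one element of a.
    The folding is injective only at a fixed length, so the length is paired on as well. *)
Lemma small_finsub X : small X -> small (finsub X).
Proof.
move=> [a [ak ainf [f [fa fi]]]]; exists a; split=> //.
have [p [pa pi]] := Hessenberg ainf.
have /infiniteP/(embedsP a)[i [ia ii]] := ainf.
have {}ia n : i n ∈ a by apply: ia.
have {}ii m n : i m = i n -> m = n by apply: ii.
pose enc := fix enc n (s : nat -> U) := if n is n'.+1
  then p (f (s n')) (enc n' s) else i 0%N.
have enca n s : (forall m, (m < n)%N -> X (s m)) -> enc n s ∈ a.
  elim: n => [|n IH] sX //=; apply: pa; first by apply/fa/sX.
  by apply: IH => m mn; apply/sX/leqW.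
have enci n s s' : (forall m, (m < n)%N -> X (s m)) ->
    (forall m, (m < n)%N -> X (s' m)) -> enc n s = enc n s' ->
    forall m, (m < n)%N -> s m = s' m.
  elim: n => [|n IH] // sX s'X /= /pi[]; rewrite -?elemsE //.
  - exact/fa/sX.
  - by apply: enca => m mn; apply/sX/leqW.
  - exact/fa/s'X.
  - by apply: enca => m mn; apply/s'X/leqW.
  move=> /fi e /IH es m; rewrite ltnS leq_eqVlt => /predU1P[->|mn].
    by apply: e; [apply: sX|apply: s'X].
  by apply: es mn => j jn; [apply/sX/leqW|apply/s'X/leqW].
have /choice[c cP] u : exists c : nat * (nat -> U), finite_set (elems u) ->
    elems u = c.2 @` `I_c.1.
  have [/(finite_set_image u)[n [s us]]|] := pselect (finite_set (elems u)).
    by exists (n, s).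
  by exists (0%N, fun=> u).
have cX u : finsub X u -> forall m, (m < (c u).1)%N -> X ((c u).2 m).
  by move=> [ufin uX] m mc; apply: uX; rewrite cP //; exists m.
exists (fun u => p (i (c u).1) (enc (c u).1 (c u).2)); split=> [u uX|u v uX vX].
  by apply: pa; [exact: ia|exact: (enca _ _ (cX _ uX))].
move=> /pi[] //; try exact: ia; try exact: (enca _ _ (cX _ uX));
  try exact: (enca _ _ (cX _ vX)); move=> /ii e.
have := cX _ uX; rewrite e => uX' /enci - /(_ uX' (cX _ vX)) es.
apply: elems_inj; rewrite (cP u uX.1) (cP v vX.1) e.
by apply/seteqP; split=> _ [m mn <-]; exists m => //; rewrite es.
Qed.

Lemma Hset_small x : H x <-> small (trcl x).
Proof. by rewrite smallP. Qed.

Lemma Hset_sub_trcl x P : small P -> elems x `<=` P -> is_transitive P -> H x.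
Proof.
move=> Ps xP PT; apply/Hset_small; apply: small_embeds Ps.
by apply: sub_embeds; apply: trcl_sub.
Qed.

Lemma Hset_U x y : H x -> H y -> H (set_of (elems x `|` elems y)).
Proof.
move=> /Hset_small xs /Hset_small ys; apply: (Hset_sub_trcl (smallU xs ys)).
  rewrite set_ofE; last by apply: is_setU; [exists x|exists y].
  by move=> z [/trcl_elems|/trcl_elems]; [left|right].
by move=> z w [/trcl_transitive zx|/trcl_transitive zy] wz; [left|right];
   [apply: zx|apply: zy].
Qed.

Lemma Hset_set1 x : H x -> H (set_of [set x]).
Proof.
move=> /Hset_small xs; apply: (Hset_sub_trcl (smallU xs (small1 x))).
  by rewrite elems_set1; right.
move=> z w [/trcl_transitive zx|->] wz; left; first exact: zx.
exact: trcl_elems.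
Qed.

Lemma Hset_set2 x y : H x -> H y -> H (set_of [set x; y]).
Proof.
by move=> /Hset_set1 hx /Hset_set1 hy; have := Hset_U hx hy; rewrite !elems_set1.
Qed.

Lemma is_set_finsub x : is_set (finsub (elems x)).
Proof. by apply: (@is_set_powerset _ x) => y []. Qed.

Lemma Hset_finsub x : H x -> H (set_of (finsub (elems x))).
Proof.
move=> /[dup] Hx /Hset_small xs.
have fs : small (finsub (elems x)).
  apply: small_finsub; apply: small_embeds xs.
  exact/sub_embeds/trcl_elems.
apply: (Hset_sub_trcl (smallU fs xs)).
  by rewrite set_ofE; [left|exact: is_set_finsub].
move=> z w [[_ zx]|/trcl_transitive zx] wz; right; last exact: zx.
exact/trcl_elems/zx.
Qed.

End Hereditary.

(** * Definability with parameters *)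

Fixpoint fbound p := match p with
  | FMem i j | FEq i j => (maxn i j).+1
  | FNot q => fbound q
  | FAnd q r => maxn (fbound q) (fbound r)
  | FAll i q => maxn i.+1 (fbound q)
  end.

(* Bound variables become n, n+1, ..., above all the r i.                     *)
Fixpoint fren (r : nat -> nat) n p := match p with
  | FMem i j => FMem (r i) (r j)
  | FEq i j => FEq (r i) (r j)
  | FNot q => FNot (fren r n q)
  | FAnd q q' => FAnd (fren r n q) (fren r n q')
  | FAll i q => FAll n (fren (fun k => if k == i then n else r k) n.+1 q)
  end.

Section Renaming.
Variables (U : zfcUniverse) (P : set U).

Lemma sat_eq p (e e' : nat -> U) : (forall i, (i < fbound p)%N -> e i = e' i) ->
  sat P e p <-> sat P e' p.
Proof.
elim: p e e' => [i j|i j|q IH|q IHq r IHr|i q IH] e e' ee /=.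
- by rewrite !ee //= ltnS ?leq_maxr ?leq_maxl.
- by rewrite !ee //= ltnS ?leq_maxr ?leq_maxl.
- by rewrite (IH e e').
- by rewrite (IHq e e') ?(IHr e e') // => k lk; apply: ee;
    rewrite /= leq_max lk ?orbT.
- have E x : sat P (fun j => if j == i then x else e j) q <->
    sat P (fun j => if j == i then x else e' j) q.
    by apply: IH => k kq; case: eqP => // _; apply: ee; rewrite /= leq_max kq orbT.
  by split=> h x /h /E.
Qed.

Lemma sat_ren p r n (e : nat -> U) : (forall i, (i < fbound p)%N -> (r i < n)%N) ->
  sat P e (fren r n p) <-> sat P (e \o r) p.
Proof.
elim: p r n e => [i j|i j|q IH|q IHq q' IHq'|i q IH] r n e rn //=.
- by rewrite IH.
- by rewrite IHq ?IHq' // => k lk; apply: rn; rewrite /= leq_max lk ?orbT.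
- have E x : sat P (fun j => if j == n then x else e j)
      (fren (fun k => if k == i then n else r k) n.+1 q) <->
    sat P (fun j => if j == i then x else (e \o r) j) q.
    rewrite IH => [|k kq].
      apply: sat_eq => k kq /=; case: (k =P i) => [_|_]; first by rewrite eqxx.
      suff /ltn_eqF -> : (r k < n)%N by [].
      by apply: rn; rewrite /= leq_max kq orbT.
    by case: (k =P i) => // _; apply/leqW/rn; rewrite /= leq_max kq orbT.
  by split=> h x /h /E.
Qed.

End Renaming.

Record model (U : zfcUniverse) := Model {
  height : U;
  height_ord : is_ordinal height;
  height_unctbl : ~ countable (elems height);
  mset : set U;
  mset_elem : elementary mset (Hset height);
  mpoint : U;
  mset_point : mset mpoint
}.

Definition scons T (x : T) (w : nat -> T) i := if i is j.+1 then w j else x.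

Section Definability.
Variables (U : zfcUniverse) (M : model U).
Implicit Types (x y z a b d u v : U).
Notation H := (Hset (height M)).
Notation N := (mset M).
Let lO := height_ord M.
Let lN := @height_unctbl _ M.

Lemma mset_sub : N `<=` H.
Proof. by have [] := mset_elem M. Qed.

(* The parameters q occupy the odd variables.                                 *)
Definition interleave (q w : nat -> U) i := if odd i then q i./2 else w i./2.

Definition rdef (F : (nat -> U) -> Prop) :=
  exists p q, (forall i, N (q i)) /\ forall w, sat H (interleave q w) p <-> F w.

Lemma interleave_odd q w i : interleave q w i.*2.+1 = q i.
Proof. by rewrite /interleave /= odd_double /= uphalf_double. Qed.

Lemma interleave_even q w i : interleave q w i.*2 = w i.
Proof. by rewrite /interleave /= odd_double half_double. Qed.

(** All changes of variables and of parameters go through this lemma: a new layout is given by a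
    renaming r of indices, which [fren] carries out with bound variables above the values of r. *)
Lemma rdef_via p q q' (F : (nat -> U) -> Prop) (s : (nat -> U) -> nat -> U) r :
  (forall i, N (q' i)) ->
  (forall w i, interleave q (s w) i = interleave q' w (r i)) ->
  (forall w, sat H (interleave q (s w)) p <-> F w) ->
  exists p', forall w, sat H (interleave q' w) p' <-> F w.
Proof.
move=> q'N sE pE; pose n := (\max_(i < fbound p) r i).+1.
exists (fren r n p) => w; rewrite -pE sat_ren => [|i ip].
  by apply: sat_eq => i _; rewrite /= sE.
by rewrite ltnS (leq_bigmax (Ordinal ip)).
Qed.

Lemma rdef_ren F (r : nat -> nat) : rdef F -> rdef (fun w => F (w \o r)).
Proof.
move=> [p [q [qN pE]]].
have [w i|p' p'E] := @rdef_via p q q (fun w => F (w \o r)) (fun w => w \o r)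
  (fun i => if odd i then i else (r i./2).*2) qN _ (fun w => pE _).
  by case: ifP => oi; rewrite ?interleave_even /interleave oi.
by exists p', q.
Qed.

(** Conjunction needs one parameter sequence for both formulas; q at the odd and q' at the even
    places of [q2] gives it. *)
Lemma rdef_join F G : rdef F -> rdef G -> exists p p' q, [/\ forall i, N (q i),
  forall w, sat H (interleave q w) p <-> F w &
  forall w, sat H (interleave q w) p' <-> G w].
Proof.
move=> [p [q [qN pE]]] [p' [q' [q'N p'E]]]; pose q2 := interleave q q'.
have q2N i : N (q2 i) by rewrite /q2 /interleave; case: ifP.
have [w i|p2 p2E] := @rdef_via p q q2 F id
  (fun i => if odd i then (i./2.*2.+1).*2.+1 else i) q2N _ pE.
  case: ifP => oi; last by rewrite /interleave oi.
  by rewrite interleave_odd /q2 interleave_odd /interleave oi.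
have [w i|p3 p3E] := @rdef_via p' q' q2 G id
  (fun i => if odd i then (i./2.*2).*2.+1 else i) q2N _ p'E.
  case: ifP => oi; last by rewrite /interleave oi.
  by rewrite interleave_odd /q2 interleave_even /interleave oi.
by exists p2, p3, q2.
Qed.

Lemma rdef_not F : rdef F -> rdef (fun w => ~ F w).
Proof. by move=> [p [q [qN pE]]]; exists (FNot p), q; split=> // w /=; rewrite pE. Qed.

Lemma rdef_and F G : rdef F -> rdef G -> rdef (fun w => F w /\ G w).
Proof.
move=> hF /(rdef_join hF)[p [p' [q [qN pE p'E]]]]; exists (FAnd p p'), q.
by split=> // w /=; rewrite pE p'E.
Qed.

Lemma rdef_mem i j : rdef (fun w => w i ∈ w j).
Proof.
exists (FMem i.*2 j.*2), (fun=> mpoint M); split=> [_|w /=]; first exact: mset_point.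
by rewrite !interleave_even.
Qed.

Lemma rdef_eq i j : rdef (fun w => w i = w j).
Proof.
exists (FEq i.*2 j.*2), (fun=> mpoint M); split=> [_|w /=]; first exact: mset_point.
by rewrite !interleave_even.
Qed.

Lemma rdef_cst F x : N x -> rdef F -> rdef (fun w => F (scons x w)).
Proof.
move=> xN [p [q [qN pE]]]; pose q' := scons x q.
have q'N i : N (q' i) by case: i.
have [w i|p' p'E] := @rdef_via p q q' (fun w => F (scons x w)) (scons x)
  (fun i => if odd i then i.+2 else if i is i'.+2 then i' else 1%N) q'N _
  (fun w => pE _); last by exists p', q'.
  case: ifP => oi; first by rewrite /interleave /= negbK oi.
  by case: i oi => [|[//|i]] //=; rewrite /interleave /= negbK => ->.
Qed.

(** Binding variable 0 of [scons x w]: it is renamed to a fresh index n, and the other even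
    variables move down by two so that w interprets them. *)
Let bind p : exists n p', forall q w P x,
  sat P (fun j => if j == n then x else interleave q w j) p' <->
  sat P (interleave q (scons x w)) p.
Proof.
pose r n i := if odd i then i else if i is i'.+2 then i' else n : nat.
pose n := fbound p; exists n, (fren (r n) n.+1 p) => q w P x.
have rn i : (i < fbound p)%N -> i != 0%N -> (r n i < n)%N.
  move=> ip i0; rewrite /r; case: ifP => // oi.
  by case: i i0 ip oi => [|[|i]] //= _ /ltnW /ltnW.
rewrite sat_ren => [|i ip]; last first.
  by have [->|i0] := eqVneq i 0%N; [rewrite /r /= ltnS|apply/leqW/rn].
apply: sat_eq => i ip /=; have [->|i0] := eqVneq i 0%N; first by rewrite /= eqxx.
rewrite (ltn_eqF (rn _ ip i0)) /r /interleave.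
case: (boolP (odd i)) => [->//|oi].
by case: i i0 oi ip => [|[|i]] //=; rewrite negbK => _ /negbTE ->.
Qed.

Lemma rdef_all F : rdef F -> rdef (fun w => forall x, H x -> F (scons x w)).
Proof.
move=> [p [q [qN pE]]]; have [n [p' p'E]] := bind p; exists (FAll n p'), q.
by split=> // w; split=> /= h x Hx; [rewrite -pE -p'E; apply: h
  |rewrite p'E pE; apply: h].
Qed.

(** If no point of N were a witness, elementarity at each point of N would make the universal
    negation true in N; elementarity for that sentence then makes it true in H(lambda), against
    x. *)
Theorem Tarski_Vaught F w : rdef F -> (forall i, N (w i)) ->
  (exists x, H x /\ F (scons x w)) -> exists x, N x /\ F (scons x w).
Proof.
move=> [p [q [qN pE]]] wN [x [Hx Fx]]; have [n [p' p'E]] := bind p.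
have [_ elem] := mset_elem M; pose e := interleave q w.
have eN i : N (e i) by rewrite /e /interleave; case: ifP.
apply: contrapT => h; have : sat N e (FAll n (FNot p')).
  move=> y Ny /=; rewrite elem; last by move=> j; case: ifP.
  by rewrite p'E pE => Fy; apply: h; exists y.
by rewrite elem // => /(_ x Hx); apply; apply/p'E; apply/pE.
Qed.

(* A context is a type of valuations of finitely many variables; an element   *)
(* of E interprets the i-th variable by cenv e i.                             *)
Record ctx := Ctx { cval :> Type; cenv : cval -> nat -> U }.

Implicit Type E : ctx.

Definition ctx0 := @Ctx unit (fun _ _ => mpoint M).

Definition ext (E : ctx) T (c : T -> U) : ctx :=
  @Ctx (E * T) (fun et => scons (c et.2) (cenv et.1)).

Definition dpred (E : ctx) (P : E -> Prop) :=
  exists F, rdef F /\ forall e, F (cenv e) <-> P e.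

(** A term is definable through its graph. Here the candidate value ranges over all of U; by
    [dterm_intro] it is enough to let it range over H(lambda). *)
Definition dterm (E : ctx) (t : E -> U) :=
  (forall e, H (t e)) /\
  dpred (E := ext E id) (fun ex : ext E id => t ex.1 = ex.2).

Lemma dpred_eqv E (P Q : E -> Prop) : (forall e, P e <-> Q e) ->
  dpred P -> dpred Q.
Proof. by move=> PQ [F [hF FE]]; exists F; split=> // e; rewrite FE. Qed.

Lemma dpred_map (E F : ctx) (f : F -> E) (r : nat -> nat) (P : E -> Prop) :
  (forall e i, cenv (f e) i = cenv e (r i)) -> dpred P ->
  dpred (fun e => P (f e)).
Proof.
move=> fr [G [hG GE]]; exists (fun w => G (w \o r)); split; first exact: rdef_ren.
by move=> e; rewrite -GE; have -> : cenv (f e) = cenv e \o r by apply/funext.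
Qed.

Lemma dnot E (P : E -> Prop) : dpred P -> dpred (fun e => ~ P e).
Proof.
by move=> [F [hF FE]]; exists (fun w => ~ F w); split=> [|e];
  [exact: rdef_not|rewrite FE].
Qed.

Lemma dand E (P Q : E -> Prop) : dpred P -> dpred Q -> dpred (fun e => P e /\ Q e).
Proof.
move=> [F [hF FE]] [G [hG GE]]; exists (fun w => F w /\ G w).
by split=> [|e]; [exact: rdef_and|rewrite FE GE].
Qed.

Lemma dor E (P Q : E -> Prop) : dpred P -> dpred Q -> dpred (fun e => P e \/ Q e).
Proof.
move=> hP hQ; apply: dpred_eqv (dnot (dand (dnot hP) (dnot hQ))) => e.
by rewrite not_andE !notK.
Qed.

Lemma dimp E (P Q : E -> Prop) : dpred P -> dpred Q -> dpred (fun e => P e -> Q e).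
Proof.
move=> hP hQ; apply: dpred_eqv (dor (dnot hP) hQ) => e.
by split=> [[]//|PQ]; have [/PQ|] := pselect (P e); [right|left].
Qed.

Lemma diff E (P Q : E -> Prop) : dpred P -> dpred Q ->
  dpred (fun e => P e <-> Q e).
Proof. by move=> hP hQ; apply: dand; apply: dimp. Qed.

Definition hval (x : {x | H x}) : U := sval x.

Lemma dallH E (P : E -> U -> Prop) :
  dpred (E := ext E hval) (fun ex : ext E hval => P ex.1 (hval ex.2)) ->
  dpred (fun e => forall x, H x -> P e x).
Proof.
move=> [F [hF FE]]; exists (fun w => forall x, H x -> F (scons x w)).
split=> [|e]; first exact: rdef_all.
by split=> h x Hx; have := h x Hx; rewrite -(FE (e, exist _ x Hx)).
Qed.

Lemma dexH E (P : E -> U -> Prop) :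
  dpred (E := ext E hval) (fun ex : ext E hval => P ex.1 (hval ex.2)) ->
  dpred (fun e => exists x, H x /\ P e x).
Proof.
move=> hP; have := dnot (dallH (P := fun e x => ~ P e x) (dnot hP)).
apply: dpred_eqv => e; split=> [h|[x [Hx Px]] h]; last exact: (h x Hx).
by apply: contrapT => h'; apply: h => x Hx Px; apply: h'; exists x.
Qed.

Lemma denv_in E i j : dpred (fun e : E => cenv e i ∈ cenv e j).
Proof. by exists (fun w => w i ∈ w j); split=> //; apply: rdef_mem. Qed.

Lemma denv_eq E i j : dpred (fun e : E => cenv e i = cenv e j).
Proof. by exists (fun w => w i = w j); split=> //; apply: rdef_eq. Qed.

Lemma dterm_weak E T (c : T -> U) (t : E -> U) :
  dterm t -> dterm (fun e : ext E c => t e.1).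
Proof.
move=> [Ht dt]; split=> //.
pose f (e : ext (ext E c) id) : ext E id := (e.1.1, e.2).
by apply: (@dpred_map _ _ f (fun i => if i is j.+1 then j.+2 else 0%N) _ _ dt) => e [].
Qed.

Lemma dterm_env E i : (forall e : E, H (cenv e i)) -> dterm (fun e : E => cenv e i).
Proof. by move=> He; split=> //; apply: (denv_eq (ext E id) i.+1 0). Qed.

Lemma dterm_cst E x : N x -> dterm (fun _ : E => x).
Proof.
move=> Nx; split=> [_|]; first exact: mset_sub.
exists (fun w => scons x w 0%N = scons x w 1%N); split=> [|e //].
exact: (rdef_cst Nx (rdef_eq 0 1)).
Qed.

Lemma dsubst E (P : E -> U -> Prop) (t : E -> U) : dterm t ->
  dpred (E := ext E hval) (fun ex : ext E hval => P ex.1 (hval ex.2)) ->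
  dpred (fun e => P e (t e)).
Proof.
move=> [Ht dt] hP.
pose f (ex : ext E hval) : ext E id := (ex.1, hval ex.2).
have dt' : dpred (E := ext E hval) (fun ex : ext E hval => t ex.1 = hval ex.2).
  by apply: (@dpred_map _ _ f id _ _ dt) => e i.
have := dexH (P := fun e x => t e = x /\ P e x) (dand dt' hP).
by apply: dpred_eqv => e; split=> [[x [_ [-> //]]]|Pt]; exists (t e).
Qed.

Lemma din E (s t : E -> U) : dterm s -> dterm t -> dpred (fun e => s e ∈ t e).
Proof.
move=> ds dt; apply: (dsubst (P := fun e x => x ∈ t e) ds).
apply: (dsubst (P := fun (ex : ext E hval) y => hval ex.2 ∈ y)).
  exact: dterm_weak.
exact: (denv_in (ext (ext E hval) hval) 1 0).
Qed.

Lemma deq E (s t : E -> U) : dterm s -> dterm t -> dpred (fun e => s e = t e).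
Proof.
move=> ds dt; apply: (dsubst (P := fun e x => x = t e) ds).
apply: (dsubst (P := fun (ex : ext E hval) y => hval ex.2 = y)).
  exact: dterm_weak.
exact: (denv_eq (ext (ext E hval) hval) 1 0).
Qed.

Lemma dterm_intro E (t : E -> U) : (forall e, H (t e)) ->
  dpred (E := ext E hval) (fun ex : ext E hval => t ex.1 = hval ex.2) -> dterm t.
Proof.
move=> Ht dt; split=> //.
have := dexH (E := ext E id) (P := fun ex y => t ex.1 = y /\ y = ex.2).
move=> /(_ (dand _ _)) h; apply: dpred_eqv (h _ _) => [[e x]||] /=.
- by split=> [[y [_ [-> //]]]|<-]; exists (t e).
- pose f (e : ext (ext E id) hval) : ext E hval := (e.1.1, e.2).
  apply: (@dpred_map _ _ f (fun i => if i is j.+1 then j.+2 else 0%N) _ _ dt).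
  by move=> e [].
- exact: (denv_eq (ext (ext E id) hval) 0 1).
Qed.

(** H(lambda) is transitive, so a set in it is determined by its elements in H(lambda), and a
    definition of its elements defines the set. *)
Lemma dterm_ext E (t : E -> U) (P : E -> U -> Prop) : (forall e, H (t e)) ->
  dpred (E := ext E hval) (fun ex : ext E hval => P ex.1 (hval ex.2)) ->
  (forall e x, H x -> (x ∈ t e <-> P e x)) -> dterm t.
Proof.
move=> Ht hP tE; apply: dterm_intro => //.
have h : dpred (E := ext E hval) (fun ex : ext E hval =>
    forall x, H x -> (x ∈ hval ex.2 <-> P ex.1 x)).
  apply: (dallH (E := ext E hval)
    (P := fun ex x => x ∈ hval ex.2 <-> P ex.1 x)); apply: diff.
    exact: (denv_in (ext (ext E hval) hval) 0 1).
  pose f (e : ext (ext E hval) hval) : ext E hval := (e.1.1, e.2).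
  apply: (@dpred_map _ _ f (fun i => if i is j.+1 then j.+2 else 0%N) _ _ hP).
  by move=> e [].
apply: dpred_eqv h => -[e [y Hy]] /=; split=> [h|<- x]; last exact: tE.
apply: elems_inj; apply/seteqP; split=> x xt.
  have Hx := Hset_transitive lO (Ht e) xt.
  by apply/(h x Hx)/(tE e x Hx).
have Hx := Hset_transitive lO Hy xt.
by apply/(tE e x Hx)/(h x Hx).
Qed.

Lemma dterm_var E : dterm (fun e : ext E hval => hval e.2).
Proof. by apply: (dterm_env (E := ext E hval) (i := 0)) => -[e [x]]. Qed.

Lemma dallin E (P : E -> U -> Prop) (t : E -> U) : dterm t ->
  dpred (E := ext E hval) (fun ex : ext E hval => P ex.1 (hval ex.2)) ->
  dpred (fun e => forall x, x ∈ t e -> P e x).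
Proof.
move=> dt hP; have := dallH (P := fun e x => x ∈ t e -> P e x).
move=> /(_ (dimp (din (dterm_var E) (dterm_weak _ dt)) hP)).
apply: dpred_eqv => e; split=> h x xt; last exact: h.
by apply: h => //; apply: Hset_transitive lO _ _ (dt.1 e) xt.
Qed.

Lemma dprop E (P : Prop) : dpred (fun _ : E => P).
Proof.
have [p|np] := pselect P.
  by apply: dpred_eqv (denv_eq E 0 0).
by apply: dpred_eqv (dnot (denv_eq E 0 0)).
Qed.

Lemma dterm_set2 E (s t : E -> U) : dterm s -> dterm t ->
  dterm (fun e => set_of [set s e; t e]).
Proof.
move=> ds dt; apply: (dterm_ext (P := fun e x => x = s e \/ x = t e)).
- by move=> e; apply: (Hset_set2 lO lN); [apply: ds.1|apply: dt.1].
- by apply: dor; apply: deq; first [exact: dterm_var|exact: dterm_weak].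
- by move=> e x _; rewrite elemsE elems_set2.
Qed.

Lemma dterm_opair E (s t : E -> U) : dterm s -> dterm t ->
  dterm (fun e => opair (s e) (t e)).
Proof.
move=> ds dt; apply: dterm_set2; last exact: dterm_set2.
by have := dterm_set2 ds ds; under eq_fun do rewrite setUid.
Qed.

(** The formula stating equality with x has a witness in H(lambda), hence one in N, and that witness
    is x. *)
Lemma mset_term x : dterm (fun _ : ctx0 => x) -> N x.
Proof.
move=> [Hx [F [hF FE]]].
have [||y [Ny]] := @Tarski_Vaught F (fun=> mpoint M) hF.
- by move=> _; apply: mset_point.
- by exists x; split; [exact: (Hx tt)|apply/(FE (tt, x))].
by rewrite (FE (tt, y)) => /= ->.
Qed.

Lemma mset_ex (P : U -> Prop) :
  dpred (E := ext ctx0 hval) (fun e : ext ctx0 hval => P (hval e.2)) ->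
  (exists x, H x /\ P x) -> exists x, N x /\ P x.
Proof.
move=> [F [hF FE]] [x [Hx Px]].
have [||y [Ny Fy]] := @Tarski_Vaught F (fun=> mpoint M) hF.
- by move=> _; apply: mset_point.
- by exists x; split=> //; apply/(FE (tt, exist _ x Hx)).
exists y; split=> //.
exact/(FE (tt, exist _ y (mset_sub Ny))).
Qed.

End Definability.

(** * Typed definability *)

(** The sorts over which formulas quantify. They are definable classes and not elements of
    H(lambda), because the functions between two elements of H(lambda) belong to it one by one but
    need not form a set in it. *)
Record dclass (U : zfcUniverse) (M : model U) := DClass {
  car :> Type;
  code : car -> U;
  codeH : forall s, Hset (height M) (code s);
  code_inj : injective code;
  code_def : forall (E : ctx U) (t : E -> U), dterm M t ->
    dpred M (fun e : E => exists s, code s = t e)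
}.
Arguments code {U M} d.

Section Typed.
Variables (U : zfcUniverse) (M : model U).
Implicit Types (x y z a b d u v : U) (E : ctx U) (S T : dclass M).
Notation N := (mset M).
Notation dpred := (dpred M).
Notation dterm := (dterm M).
Notation ctx0 := (ctx0 M).
Notation hval := (@hval U M).

Lemma dall E S (P : E -> S -> Prop) :
  dpred (E := ext E (code S)) (fun es : ext E (code S) => P es.1 es.2) ->
  dpred (fun e => forall s, P e s).
Proof.
move=> [F [hF FE]].
have := @dallH _ M E (fun e x => (exists s, code S s = x) ->
  exists s, code S s = x /\ P e s).
have dS : dpred (E := ext E hval) (fun e => exists s, code S s = hval e.2).
  exact/code_def/dterm_var.
have dP : dpred (E := ext E hval) (fun e => exists s, code S s = hval e.2 /\ P e.1 s).
  have dF : dpred (E := ext E hval) (fun e => F (cenv e)) by exists F.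
  apply: dpred_eqv (dand dS dF) => -[e [x Hx]] /=.
  split=> [[[s sx] Fx]|[s [sx Ps]]].
    by exists s; split=> //; apply/(FE (e, s)); rewrite /= sx.
  split; first by exists s.
  by have := (FE (e, s)).2 Ps; rewrite /= sx.
move=> /(_ (dimp dS dP)); apply: dpred_eqv => e; split=> [h s|h x Hx [s sx]].
  have [|s' [/code_inj <- //]] := h (code S s) (codeH s); by exists s.
by exists s.
Qed.

Lemma dex E S (P : E -> S -> Prop) :
  dpred (E := ext E (code S)) (fun es : ext E (code S) => P es.1 es.2) ->
  dpred (fun e => exists s, P e s).
Proof.
move=> hP; have := dnot (dall (P := fun e s => ~ P e s) (dnot hP)).
apply: dpred_eqv => e; split=> [h|[s Ps] h]; last exact: (h s).
by apply: contrapT => h'; apply: h => s Ps; apply: h'; exists s.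
Qed.

Lemma dvar E S : dterm (fun e : ext E (code S) => code S e.2).
Proof. by apply: (dterm_env (E := ext E (code S)) (i := 0)) => e; apply: codeH. Qed.

Lemma internal_ex S (P : S -> Prop) :
  dpred (E := ext ctx0 (code S)) (fun e : ext ctx0 (code S) => P e.2) ->
  (exists s, P s) -> exists s, N (code S s) /\ P s.
Proof.
move=> [F [hF FE]] [s Ps].
have dS : dpred (E := ext ctx0 hval) (fun e => exists s, code S s = hval e.2).
  exact/code_def/dterm_var.
have dF : dpred (E := ext ctx0 hval) (fun e => F (cenv e)) by exists F.
have := @mset_ex _ M (fun x => exists s, code S s = x /\ P s).
have h : dpred (E := ext ctx0 hval) (fun e => exists s, code S s = hval e.2 /\ P s).
  apply: dpred_eqv (dand dS dF) => -[[] [x Hx]] /=.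
  split=> [[[s' sx] Fx]|[s' [sx Ps']]].
    by exists s'; split=> //; apply/(FE (tt, s')); rewrite /= sx.
  split; first by exists s'.
  by have := (FE (tt, s')).2 Ps'; rewrite /= sx.
move=> /(_ h)[]; first by exists (code S s); split; [exact: codeH|exists s].
by move=> x [Nx [s' [sx Ps']]]; exists s'; rewrite sx.
Qed.

Lemma internal_all S (P : S -> Prop) :
  dpred (E := ext ctx0 (code S)) (fun e : ext ctx0 (code S) => P e.2) ->
  (forall s, N (code S s) -> P s) -> forall s, P s.
Proof.
move=> hP PN s; apply: contrapT => nPs.
have [|s' [/PN]//] := @internal_ex S (fun s => ~ P s) (dnot hP).
by exists s.
Qed.

Lemma deqS E S (s t : E -> S) : dterm (fun e => code S (s e)) ->
  dterm (fun e => code S (t e)) -> dpred (fun e => s e = t e).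
Proof.
move=> ds dt; apply: dpred_eqv (deq ds dt) => e.
by split=> [/code_inj|->].
Qed.

Section Weakening.
Variables (E : ctx U) (t : E -> U).
Hypothesis dt : dterm t.
Variables (T1 T2 T3 T4 T5 : Type) (c1 : T1 -> U) (c2 : T2 -> U) (c3 : T3 -> U)
  (c4 : T4 -> U) (c5 : T5 -> U).

Lemma dterm_weak2 : dterm (fun e : ext (ext E c1) c2 => t e.1.1).
Proof. by have := dterm_weak c2 (dterm_weak c1 dt). Qed.

Lemma dterm_weak3 : dterm (fun e : ext (ext (ext E c1) c2) c3 => t e.1.1.1).
Proof. by have := dterm_weak c3 dterm_weak2. Qed.

Lemma dterm_weak4 :
  dterm (fun e : ext (ext (ext (ext E c1) c2) c3) c4 => t e.1.1.1.1).
Proof. by have := dterm_weak c4 dterm_weak3. Qed.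

Lemma dterm_weak5 :
  dterm (fun e : ext (ext (ext (ext (ext E c1) c2) c3) c4) c5 => t e.1.1.1.1.1).
Proof. by have := dterm_weak c5 dterm_weak4. Qed.

End Weakening.

End Typed.

(** Rules are selected by the syntactic shape of the body. A term that is neither a hypothesis, a
    constant of N nor one of the first variables is weakened. *)
Ltac dterm_step :=
  lazymatch goal with
  | |- dterm _ (fun e => opair _ _) => apply: dterm_opair
  | |- dterm _ (fun e => set_of [set _; _]) => apply: dterm_set2
  | |- @dterm ?U ?M ?E _ =>
      first [ assumption
            | solve [apply: dterm_cst; done]
            | solve [first [ refine (@dterm_env U M E 0 _)
                           | refine (@dterm_env U M E 1 _)
                           | refine (@dterm_env U M E 2 _)
                           | refine (@dterm_env U M E 3 _)
                           | refine (@dterm_env U M E 4 _)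
                           | refine (@dterm_env U M E 5 _)
                           | refine (@dterm_env U M E 6 _) ];
                     move=> ?; first [exact: codeH | exact: (proj2_sig _)]]
            | apply: dterm_weak | apply: dterm_weak2 | apply: dterm_weak3
            | apply: dterm_weak4 | apply: dterm_weak5 ]
  end.

Ltac dpred_step :=
  lazymatch goal with
  | |- dpred _ (fun e => _ /\ _) => apply: dand
  | |- dpred _ (fun e => _ \/ _) => apply: dor
  | |- dpred _ (fun e => _ <-> _) => apply: diff
  | |- dpred _ (fun e => ~ _) => apply: dnot
  | |- dpred ?M (fun e => exists s : car ?S, @?P e s) => apply: (@dex _ M _ S P)
  | |- dpred ?M (fun e => forall s : car ?S, @?P e s) => apply: (@dall _ M _ S P)
  | |- dpred ?M (fun e => forall x, zin x (@?t e) -> @?P e x) =>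
      apply: (@dallin _ M _ P t)
  | |- dpred ?M (fun e => forall x, Hset _ x -> @?P e x) => apply: (@dallH _ M _ P)
  | |- dpred ?M (fun e => exists x, Hset _ x /\ @?P e x) => apply: (@dexH _ M _ P)
  | |- dpred _ (fun e => _ -> _) => apply: dimp
  | |- dpred _ (fun e => @eq (car _) _ _) => apply: deqS
  | |- dpred _ (fun e => _ = _) => apply: deq
  | |- dpred _ (fun e => zin _ _) => apply: din
  end.

Ltac definable := repeat (cbv beta; first [dpred_step | dterm_step]).

(** * Functions as elements of H(lambda) *)

Section Functions.
Variables (U : zfcUniverse) (M : model U).
Implicit Types (x y z a b d u v : U) (E : ctx U) (S T : dclass M).
Notation H := (Hset (height M)).
Notation N := (mset M).
Notation dpred := (dpred M).
Notation dterm := (dterm M).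
Notation hval := (@hval U M).
Let lO := height_ord M.
Let lN := @height_unctbl _ M.
Let Htrans := Hset_transitive lO.

Definition dset S := exists X, N X /\ elems X = range (code S).

Section OfSet.
Variables (T : Type) (c : T -> U).
Hypotheses (c_inj : injective c) (c_set : exists X, N X /\ elems X = range c).

Lemma ofset_H t : H (c t).
Proof.
have [X [/mset_sub HX XE]] := c_set; apply: Htrans HX _.
by rewrite elemsE XE.
Qed.

Lemma ofset_def E (t : E -> U) : dterm t -> dpred (fun e : E => exists s, c s = t e).
Proof.
have [X [NX XE]] := c_set; move=> dt.
apply: dpred_eqv (din dt (dterm_cst E NX)) => e; rewrite elemsE XE.
by split=> [[s _ ?]|[s ?]]; exists s.
Qed.

Definition of_set : dclass M := DClass ofset_H c_inj ofset_def.

End OfSet.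

Lemma is_set_graph S0 T0 (i : S0 -> U) (j : T0 -> U) f : injective i ->
  is_set (range i) -> is_set (range (fun s => opair (i s) (j (f s)))).
Proof.
move=> iinj [X XE].
have /choice[g gP] x : exists y, forall s, i s = x -> y = opair x (j (f s)).
  have [[s <-]|h] := pselect (exists s, i s = x).
    by exists (opair (i s) (j (f s))) => s' /iinj ->.
  by exists x => s sx; case: h; exists s.
have [Y YE] := is_set_image g X; exists Y; rewrite YE XE.
apply/seteqP; split=> [_ [_ [s _ <-] <-]|_ [s _ <-]].
  by rewrite (gP (i s) s erefl); exists s.
by exists (i s); [exists s|exact: (gP (i s) s erefl)].
Qed.

Lemma dset_is_set S : dset S -> is_set (range (code S)).
Proof. by move=> [X [_ XE]]; exists X. Qed.

Lemma in_graph S T (f : S -> T) : dset S -> forall u,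
  u ∈ graph (code S) (code T) f <-> exists s, u = opair (code S s) (code T (f s)).
Proof.
move=> hS u; rewrite elemsE set_ofE; last first.
  by apply: is_set_graph; [exact: code_inj|exact: dset_is_set].
by split=> [[s _ <-]|[s ->]]; exists s.
Qed.

Lemma opair_in_graph S T (f : S -> T) s t : dset S ->
  opair (code S s) (code T t) ∈ graph (code S) (code T) f <-> t = f s.
Proof.
move=> hS; rewrite in_graph //; split=> [[s']|->]; last by exists s.
by move=> /opair_inj[/code_inj -> /code_inj].
Qed.

(* Pairs are finite sets of finite sets.                                      *)
Definition pairs x y :=
  set_of (finsub (elems (set_of (finsub (elems x `|` elems y))))).

Lemma is_setUE x y : elems (set_of (elems x `|` elems y)) = elems x `|` elems y.
Proof. by apply: set_ofE; apply: is_setU; [exists x|exists y]. Qed.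

Lemma Hset_pairs x y : H x -> H y -> H (pairs x y).
Proof.
move=> Hx Hy; rewrite /pairs -is_setUE.
by apply: (Hset_finsub lO lN); apply: (Hset_finsub lO lN); apply: Hset_U.
Qed.

Lemma opair_pairs x y u v : u ∈ x -> v ∈ y -> opair u v ∈ pairs x y.
Proof.
move=> ux vy; rewrite elemsE /pairs set_ofE; last exact: is_set_finsub.
have fE w : elems w `<=` elems x `|` elems y -> finite_set (elems w) ->
  w ∈ set_of (finsub (elems x `|` elems y)).
  by move=> wxy wf; rewrite elemsE -is_setUE set_ofE; [|exact: is_set_finsub];
     split=> //; rewrite is_setUE.
rewrite /finsub /= elems_opair; split; first exact: finite_set2.
by move=> w [->|->]; apply: fE; rewrite ?elems_set1 ?elems_set2;
  try exact: finite_set1; try exact: finite_set2;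
  move=> z; [move=> ->; left|case=> ->; [left|right]].
Qed.

Lemma graph_H S T (f : S -> T) : dset S -> dset T ->
  H (graph (code S) (code T) f).
Proof.
move=> hS; have [X [/mset_sub HX XE]] := hS; move=> [Y [/mset_sub HY YE]].
apply: Hset_sub lO (Hset_pairs HX HY) _ => u /(in_graph _ hS)[s ->].
by apply: opair_pairs; rewrite elemsE ?XE ?YE; [exists s|exists (f s)].
Qed.

Lemma graph_inj S T : dset S -> injective (graph (code S) (code T)).
Proof.
move=> hS f g fg; apply/funext => s.
have : opair (code S s) (code T (f s)) ∈ graph (code S) (code T) f.
  by rewrite opair_in_graph.
by rewrite fg opair_in_graph.
Qed.

(** Being a total single-valued relation is first order. Choice in the ambient logic turns such a
    relation into a function, so the functions of the model are the ambient ones. *)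
Lemma graph_def S T E (t : E -> U) : dset S -> dset T -> dterm t ->
  dpred (fun e : E => exists f, graph (code S) (code T) f = t e).
Proof.
move=> hS hT dt.
have h : dpred (fun e : E =>
    (forall u, u ∈ t e -> exists s r, u = opair (code S s) (code T r)) /\
    forall s, exists r, opair (code S s) (code T r) ∈ t e /\
      forall r', opair (code S s) (code T r') ∈ t e -> r' = r).
  by definable.
apply: dpred_eqv h => e; split=> [[h1 /choice[f fP]]|[f <-]].
  exists f; apply: elems_inj; apply/seteqP; split=> u.
    by move=> /(in_graph f hS)[s ->]; have [] := fP s.
  move=> /[dup] ut /h1[s [r ur]]; apply/(in_graph f hS); exists s.
  by rewrite ur; have [_ /(_ r) ->] := fP s; rewrite // -ur.
split=> [u /(in_graph f hS)[s ->]|s]; first by exists s, (f s).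
by exists (f s); rewrite opair_in_graph //; split=> // r; rewrite opair_in_graph.
Qed.

Definition arr S T (hS : dset S) (hT : dset T) : dclass M :=
  DClass (fun f => @graph_H S T f hS hT) (@graph_inj S T hS)
    (fun E t => @graph_def S T E t hS hT).

(** The value at s is the unique y whose pair with s lies in the graph. *)
Lemma dapp E S T (f : E -> S -> T) (s : E -> S) : dset S ->
  dterm (fun e => graph (code S) (code T) (f e)) -> dterm (fun e => code S (s e)) ->
  dterm (fun e => code T (f e (s e))).
Proof.
move=> hS df ds; apply: dterm_intro => [e|]; first exact: codeH.
have h : dpred (E := ext E hval) (fun e : ext E hval =>
    opair (code S (s e.1)) (hval e.2) ∈ graph (code S) (code T) (f e.1)).
  have dsw := dterm_weak hval ds; have dfw := dterm_weak hval df.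
  by apply: din; [apply: dterm_opair; [|exact: dterm_var]|].
apply: dpred_eqv h => e; split=> [|<-]; last by rewrite opair_in_graph.
by rewrite in_graph // => -[s' /opair_inj[/code_inj -> ->]].
Qed.

End Functions.

(** * Elements of the model *)

Section Internal.
Variables (U : zfcUniverse) (M : model U).
Implicit Types (x y z a b d k u v : U) (E : ctx U) (S T : dclass M).
Notation H := (Hset (height M)).
Notation N := (mset M).
Notation dpred := (dpred M).
Notation ctx0 := (ctx0 M).
Notation hval := (@hval U M).
Let lO := height_ord M.
Let lN := @height_unctbl _ M.
Let Htrans := Hset_transitive lO.

Lemma mset_def x (P : U -> Prop) : H x ->
  dpred (E := ext ctx0 hval) (fun e => P (hval e.2)) ->
  (forall y, H y -> (y ∈ x <-> P y)) -> N x.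
Proof.
move=> Hx hP xP; apply: mset_term.
by apply: (dterm_ext (P := fun=> P)) => // e y; apply: xP.
Qed.

Lemma mset_U x y : N x -> N y -> N (set_of (elems x `|` elems y)).
Proof.
move=> Nx Ny; apply: (mset_def (P := fun u => u ∈ x \/ u ∈ y)).
- by apply: Hset_U => //; apply: mset_sub.
- by definable.
- by move=> u _; rewrite elemsE is_setUE.
Qed.

Lemma mset_set1 x : N x -> N (set_of [set x]).
Proof.
move=> Nx; rewrite -[[set x]]setUid -[_ `|` _]/[set x; x].
by apply: mset_term; definable.
Qed.

Lemma is_set_finite (X : set U) : finite_set X -> is_set X.
Proof.
move=> /(finite_set_image (mpoint M))[n [s ->]]; elim: n => [|n IH].
  by rewrite II0 image_set0; apply: is_set0.
by rewrite IIS image_setU image_set1; apply: is_setU => //; apply: is_set1.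
Qed.

Lemma mset_finite (X : set U) : finite_set X -> X `<=` N -> N (set_of X).
Proof.
move=> /(finite_set_image (mpoint M))[n [s ->]]; elim: n => [|n IH] sN.
  rewrite II0 image_set0; apply: (mset_def (P := fun=> False)).
  - apply: (Hset_sub lO (mset_sub (mset_point M))).
    by rewrite set_ofE //; apply: is_set0.
  - exact: dprop.
  - by move=> y _; rewrite elemsE set_ofE //; apply: is_set0.
rewrite IIS image_setU image_set1.
have Xn : is_set (s @` `I_n) by apply/is_set_finite/finite_image/finite_II.
rewrite -(set_ofE Xn) -(elems_set1 (s n)); apply: mset_U.
  by apply: IH => _ [m mn <-]; apply: sN; exists m => //; apply: ltnW.
by apply/mset_set1/sN; exists n => /=.
Qed.

(* The finite set of the elements of x in N is in N; if it differed from x,   *)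
(* then N would contain an element of the difference.                         *)
Lemma finite_sub_mset x : N x -> finite_set (elems x) -> elems x `<=` N.
Proof.
move=> Nx xf; pose Y := elems x `&` N.
have Yf : finite_set Y by apply: sub_finite_set xf => y [].
have NY : N (set_of Y) by apply: mset_finite => // y [].
have YE : elems (set_of Y) = Y by apply/set_ofE/is_set_finite.
move=> y yx; apply: contrapT => nNy.
have [||z [Nz [zx zY]]] := @mset_ex _ M (fun y => y ∈ x /\ ~ y ∈ set_of Y).
- by definable.
- exists y; split; first exact: Htrans (mset_sub Nx) yx.
  by rewrite elemsE [in X in _ /\ ~ X]elemsE YE; split=> // -[].
by apply: zY; rewrite elemsE YE.
Qed.

Lemma mset_opair x y : N (opair x y) <-> N x /\ N y.
Proof.
split=> [Nxy|[Nx Ny]]; last by apply: mset_term; definable.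
have : N (set_of [set x; y]).
  apply: (finite_sub_mset Nxy); rewrite elems_opair; first exact: finite_set2.
  by right.
move=> /finite_sub_mset; rewrite elems_set2 => /(_ (finite_set2 _ _)) h.
by split; apply: h; [left|right].
Qed.

Lemma mset_app S T (f : S -> T) s : dset S ->
  N (graph (code S) (code T) f) -> N (code S s) -> N (code T (f s)).
Proof.
move=> hS Nf Ns; apply: mset_term.
by apply: (dapp (f := fun=> f) (s := fun=> s) hS); definable.
Qed.

Lemma dset_prod S T : dset S -> dset T -> exists X, N X /\
  elems X = range (fun st : S * T => opair (code S st.1) (code T st.2)).
Proof.
move=> [X [/mset_sub HX XE]] [Y [/mset_sub HY YE]].
have [P PE] : is_set (range (fun st : S * T => opair (code S st.1) (code T st.2))).
  apply: (@is_set_sub _ (pairs X Y)) => _ [[s t] _ <-] /=.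
  by apply: opair_pairs; rewrite elemsE ?XE ?YE; [exists s|exists t].
exists P; split=> //.
apply: (mset_def (P := fun u => exists s t, u = opair (code S s) (code T t))).
- apply: (Hset_sub lO (Hset_pairs HX HY)); rewrite PE => _ [[s t] _ <-] /=.
  by apply: opair_pairs; rewrite elemsE ?XE ?YE; [exists s|exists t].
- by definable.
- move=> y _; rewrite elemsE PE.
  by split=> [[[s t] _ <-]|[s [t ->]]]; [exists s, t|exists (s, t)].
Qed.

(* finsub x is definable, as the least set that is closed in this sense.      *)
Let closed x z := (forall u, H u -> (forall v, H v -> ~ v ∈ u) -> u ∈ z) /\
  forall u, u ∈ z -> forall y, y ∈ x -> forall w, H w ->
    (forall v, H v -> (v ∈ w <-> v ∈ u \/ v = y)) -> w ∈ z.

Lemma mset_finsub x : N x -> N (set_of (finsub (elems x))).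
Proof.
move=> Nx; have Hx := mset_sub Nx.
have HF : H (set_of (finsub (elems x))) by apply: Hset_finsub.
have FE : elems (set_of (finsub (elems x))) = finsub (elems x).
  exact/set_ofE/is_set_finsub.
apply: (mset_def (P := fun u => forall z, H z -> closed x z -> u ∈ z)) => //.
  by rewrite /closed; definable.
move=> u Hu; split=> [|]; last first.
  apply=> //; split=> [v Hv v0|v].
    have -> : v = set_of set0.
      apply: elems_inj; rewrite set_ofE; last exact: is_set0.
      by apply/seteqP; split=> // w wv; apply: (v0 w) => //; apply: Htrans wv.
    rewrite elemsE FE /finsub /= set_ofE; last exact: is_set0.
    by split=> //; apply: finite_set0.
  rewrite elemsE FE => -[vf vx] y yx w Hw wE; rewrite elemsE FE.
  have {}wE : elems w = elems v `|` [set y].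
    apply/seteqP; split=> z zw.
      by apply/(wE z (Htrans Hw zw)).
    apply/(wE z _) => //; case: zw => [/vx zx|->]; exact: Htrans Hx _.
  rewrite /finsub /= wE; split.
    by rewrite finite_setU; split=> //; apply: finite_set1.
  by move=> z [/vx //|->].
rewrite elemsE FE => -[uf ux] z Hz [z0 zS].
have [n [s us]] := finite_set_image x uf.
have sx m : (m < n)%N -> s m ∈ x by move=> mn; apply: ux; rewrite us; exists m.
suff [v [vz vE]] : exists v, v ∈ z /\ elems v = s @` `I_n.
  by rewrite (_ : u = v) //; apply: elems_inj; rewrite us vE.
elim: n sx {us} => [|n IH] sx.
  have e0 : elems (set_of set0) = (@set0 U) by apply/set_ofE/is_set0.
  exists (set_of set0); rewrite II0 image_set0 e0; split=> //; apply: z0.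
    by apply: Hset_sub lO Hx _; rewrite e0.
  by move=> v _; rewrite elemsE e0.
have [v [vz vE]] := IH (fun m mn => sx m (ltnW mn)).
have wE : elems (set_of (elems v `|` [set s n])) = elems v `|` [set s n].
  by apply/set_ofE/is_setU; [exists v|exact: is_set1].
exists (set_of (elems v `|` [set s n])); split; last first.
  by rewrite wE IIS image_setU image_set1 vE.
apply: (zS v vz (s n) (sx n (ltnSn n))).
  apply: Hset_sub lO Hx _; rewrite wE vE => _ [[m mn <-]|->]; apply: sx => //.
  exact: ltnW.
by move=> w _; rewrite elemsE wE.
Qed.

(** A difference between x and y would have a witness in H(lambda), and so one in N. *)
Lemma mset_eq x y : N x -> N y -> elems x `&` N = elems y `&` N -> x = y.
Proof.
move=> Nx Ny xy; apply: contrapT => nxy.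
have [||z [Nz]] := @mset_ex _ M (fun z => ~ (z ∈ x <-> z ∈ y)).
- by definable.
- apply: contrapT => h; apply: nxy; apply: zfc_extensionality => z.
  have [Hz|nHz] := pselect (H z).
    by apply: contrapT => nz; apply: h; exists z.
  by split=> zx; case: nHz; [apply: Htrans (mset_sub Nx) zx|apply: Htrans (mset_sub Ny) zx].
apply; have := congr1 (@^~ z) xy; rewrite /setI /= propeqE => h.
by split=> zx; [have [] := h.1 (conj zx Nz)|have [] := h.2 (conj zx Nz)].
Qed.

Definition guesses := forall x (X : set U), N x -> X `<=` elems x -> X `<=` N ->
  exists g, N g /\ elems g `&` N = X.

(** The image of X under the collapse is a subset of the image of x, hence lies in H(mu), hence is
    the image of some g in N. Since the collapse is injective on N, the trace of g is X. *)
Lemma guessing : zero_guessing (height M) N -> guesses.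
Proof.
move=> [m [[mO _] _ [pi piM piH]]] x X Nx Xx XN.
have pi_inj y z : N y -> N z -> pi y = pi z -> y = z.
  move=> Ny; have Hy := mset_sub Ny; move: y Hy Ny z.
  apply: (Hset_ind lO) => y Hy IH Ny z Nz e; apply: mset_eq => //.
  have eE := piM _ Ny; rewrite e (piM _ Nz) in eE.
  apply/seteqP; split=> u [ue Nu]; split=> //.
    have : (pi @` (N `&` elems y)) (pi u) by exists u.
    rewrite -eE => -[v [Nv vz]] /esym /(IH u ue Nu v Nv) uv.
    by rewrite uv.
  have : (pi @` (N `&` elems z)) (pi u) by exists u.
  by rewrite eE => -[v [Nv vy]] /(IH v vy Nv u Nu) <-.
have [y yE] : is_set (pi @` X).
  by apply: (@is_set_sub _ (pi x)); rewrite piM // => _ [u Xu <-]; exists u;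
    split=> //; [apply: XN|apply: Xx].
have : Hset m y.
  have Hpx : Hset m (pi x) by rewrite -piH; exists x.
  apply: Hset_sub mO Hpx _; rewrite yE piM // => _ [u Xu <-]; exists u => //.
  by split; [apply: XN|apply: Xx].
rewrite -piH => -[g Ng gy]; exists g; split=> //.
have := piM _ Ng; rewrite gy yE => e; apply/seteqP; split=> u.
  move=> [ug Nu]; have : (pi @` (N `&` elems g)) (pi u) by exists u.
  by rewrite -e => -[v Xv /(pi_inj _ _ (XN _ Xv) Nu) <-].
move=> Xu; have : (pi @` X) (pi u) by exists u.
rewrite e => -[v [Nv vg] /(pi_inj _ _ Nv (XN _ Xu)) vu].
by rewrite -vu.
Qed.

(* is_ordinal in the bounded quantifiers that the tactic definable handles.   *)
Let ordinal a := (forall x, x ∈ a -> forall y, y ∈ x -> y ∈ a) /\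
  forall x, x ∈ a -> forall y, y ∈ x -> forall z, z ∈ y -> z ∈ x.

Let ordinalP a : ordinal a <-> is_ordinal a.
Proof.
split=> [[aT ae]|[aT ae]]; split.
- by move=> x y xa yx; apply: aT yx.
- by move=> y ya u v uy vu; apply: ae vu.
- by move=> x xa y yx; apply: aT yx.
- by move=> x xa y yx z zy; apply: (ae x) zy.
Qed.

Let onto S a g := (forall s, exists x, H x /\ x ∈ a /\ opair x (code S s) ∈ g) /\
  forall x, x ∈ a -> forall s, opair x (code S s) ∈ g ->
    forall s', opair x (code S s') ∈ g -> s = s'.

(* The least ordinal that maps onto S is in N and below k, hence is included  *)
(* in N.                                                                      *)
Lemma mset_all S k : dset S -> is_ordinal k -> elems k `<=` elems (height M) ->
  (exists d, d ∈ k /\ N `&` elems k = elems d) ->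
  card_lt [set: S] k -> forall s, N (code S s).
Proof.
move=> hS kO kl [d [dk dE]] /card_lt_embeds[a0 [a0k [f [fa fi]]]].
have [X [NX XE]] := hS; have HX := mset_sub NX.
pose surj a := exists g, H g /\ onto S a g.
have surj0 : surj a0.
  have Ha0 : H a0 by apply: Hset_ord => //; apply: kl.
  have fp s : opair (f s) (code S s) ∈ pairs a0 X.
    by apply: opair_pairs; rewrite elemsE; [exact: fa|rewrite XE; exists s].
  have [g gE] : is_set (range (fun s => opair (f s) (code S s))).
    by apply: (@is_set_sub _ (pairs a0 X)) => _ [s _ <-]; apply: fp.
  exists g; split.
    by apply: (Hset_sub lO (Hset_pairs Ha0 HX)); rewrite gE => _ [s _ <-]; apply: fp.
  split=> [s|x xa s].
    exists (f s); split; first by apply: Htrans Ha0 _; apply: fa.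
    by split; [apply: fa|rewrite elemsE gE; exists s].
  rewrite elemsE gE => -[s1 _ /opair_inj[<- /code_inj <-]] s'.
  by rewrite elemsE gE => -[s2 _ /opair_inj[+ /code_inj <-]] => /fi ->.
have [|a1 [a1k surj1 min1]] := @ord_min _ k surj kO; first by exists a0.
have Hk a : a ∈ k -> H a by move=> ak; apply: Hset_ord => //; apply: kl.
have [||a [Na [/ordinalP aO [surja mina]]]] := @mset_ex _ M
    (fun a => ordinal a /\ surj a /\ forall b, b ∈ a -> ~ surj b).
- by rewrite /ordinal /surj /onto; definable.
- exists a1; split; first exact: Hk.
  by split; first by apply/ordinalP/(ord_mem kO a1k).
(* The ordinal a found in N is minimal in the same sense as a1, so the two coincide; this places a
   below k. *)
have a1O := ord_mem kO a1k.
have aa1 : a = a1.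
  have [s1|s1] := ord_total aO a1O.
    by have [//|/min1] := ord_sub a1O aO s1.
  by have [->//|/mina] := ord_sub aO a1O s1.
have aN x : x ∈ a -> N x.
  move=> xa; have ad : a ∈ d by rewrite elemsE -dE; split=> //; rewrite aa1.
  have [dT _] := ord_mem kO dk.
  by have := dT _ _ ad xa; rewrite -dE => -[].
have [|g [Ng [sg fg]]] := @mset_ex _ M (onto S a) _ surja.
  by rewrite /onto; definable.
move=> s; have [x [_ [xa xs]]] := sg s.
have Nx := aN _ xa.
(* The code of s is definable from x and g, as the unique value of g at x. *)
apply: mset_term; apply: dterm_intro => [_|]; first exact: codeH.
have h : dpred (E := ext ctx0 hval) (fun e =>
    exists t, opair x (code S t) ∈ g /\ hval e.2 = code S t).
  by definable.
apply: dpred_eqv h => e; split=> [[t [xt ->]]|<-]; last by exists s.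
by rewrite (fg x xa s xs t xt).
Qed.

Hypothesis guess : guesses.

Lemma internal_graph_eq S T (f g : S -> T) (hS : dset S) (hT : dset T) :
  N (graph (code S) (code T) f) -> N (graph (code S) (code T) g) ->
  (forall s, N (code S s) -> f s = g s) -> f = g.
Proof.
move=> Nf Ng fg; apply/funext; apply: internal_all => //.
pose E1 := ext ctx0 (code S).
by apply: deqS; [apply: (dapp hS (E := E1) (f := fun=> f) (s := fun e => e.2))
  |apply: (dapp hS (E := E1) (f := fun=> g) (s := fun e => e.2))]; definable.
Qed.

(** The graph of f is the trace of some g in N, a relation that is total by elementarity.
    Elementarity also gives a selector h of g in N; at a point of N its value is in N and related to
    the point by g, so it is the value of f. *)
Theorem internal_lift S T (f : S -> T) : dset S -> dset T ->
  (forall s, N (code S s) -> N (code T (f s))) ->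
  exists g : S -> T, N (graph (code S) (code T) g) /\
    forall s, N (code S s) -> g s = f s.
Proof.
move=> hS hT Nf; have [P [NP PE]] := dset_prod hS hT.
pose X := [set opair (code S s) (code T (f s)) | s in [set s | N (code S s)]].
have [||g [Ng gE]] := guess (X := X) NP.
- by rewrite PE => _ [s _ <-]; exists (s, f s).
- by move=> _ [s Ns <-]; apply/mset_opair; split=> //; apply: Nf.
have gP s t : N (code S s) -> N (code T t) ->
    (opair (code S s) (code T t) ∈ g <-> t = f s).
  move=> Ns Nt; have -> : (opair (code S s) (code T t) ∈ g) =
      (elems g `&` N) (opair (code S s) (code T t)).
    rewrite propeqE; split=> [h|[]//]; split=> //; exact/mset_opair.
  rewrite gE; split=> [[s' _ /opair_inj[/code_inj -> /code_inj]//]|->].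
  by exists s.
have tot : forall s, exists t, opair (code S s) (code T t) ∈ g.
  apply: internal_all => [|s Ns]; first by definable.
  by exists (f s); apply/gP => //; apply: Nf.
have /choice[h0 h0P] := tot.
have [||h [Nh hP]] := @internal_ex _ M (arr hS hT)
    (fun h => forall s, opair (code S s) (code T (h s)) ∈ g).
- apply: dall; apply: din; last by definable.
  apply: dterm_opair; first by definable.
  apply: (dapp hS (E := ext (ext ctx0 (code (arr hS hT))) (code S))
    (f := fun e => e.1.2) (s := fun e => e.2)); definable.
- by exists h0.
exists h; split=> // s Ns; apply/gP => //.
exact: mset_app hS Nh Ns.
Qed.

End Internal.

(** * Free modules and syzygies *)

Local Open Scope ring_scope.
Local Open Scope quotient_scope.

Section Free.
Variables (R : pzRingType) (K : choiceType).
Implicit Types (f g : freemod R K) (k : K).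

Definition coeff f k : R := (val f : K -> R^o) k.

Lemma coeffP f g : coeff f =1 coeff g -> f = g.
Proof. by move=> fg; apply/val_inj/funext. Qed.

Lemma coeffD f g k : coeff (f + g) k = coeff f k + coeff g k.
Proof. by []. Qed.

Lemma coeffZ a f k : coeff (a *: f) k = a * coeff f k.
Proof. by []. Qed.

Lemma finite_coeff f : finite_set [set k | coeff f k != 0].
Proof. by have := valP f; rewrite inE. Qed.

Lemma mkfree (h : K -> R) : finite_set [set k | h k != 0] ->
  exists f, coeff f =1 h.
Proof.
move=> hf; have hs : (h : K -> R^o) \in @finitely_supported R K by rewrite inE.
by exists (Submod (finitely_supported_submod R K) hs).
Qed.

(** Basis vectors are described by a predicate, since that is how they enter the formula that
    defines the augmentation. *)
Definition is_delta k f := coeff f k = 1 /\ forall k', k' <> k -> coeff f k' = 0.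

Lemma delta_ex k : exists f, is_delta k f.
Proof.
have [|f fE] := @mkfree (fun k' => if k' == k then 1 else 0).
  apply: sub_finite_set (finite_set1 k) => k' /=.
  by have [->//|] := eqVneq k' k; rewrite eqxx.
by exists f; split=> [|k' /eqP/negPf k'k]; rewrite fE ?eqxx ?k'k.
Qed.

Lemma free_linear_eq (V : lmodType R) (g h : freemod R K -> V) :
  linear g -> linear h -> (forall k f, is_delta k f -> g f = h f) -> g = h.
Proof.
move=> gl hl gh; have lin0 (u : freemod R K -> V) : linear u -> u 0 = 0.
  by move=> ul; have := ul (-1) 0 0; rewrite !scaler0 addr0 scaleN1r addNr.
apply/funext => f.
have /finite_seqP[s sE] := finite_coeff f.
have {sE} : forall k, coeff f k != 0 -> k \in s.
  by move=> k fk; have : [set k | coeff f k != 0] k by []; rewrite sE.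
elim: s f => [|k s IH] f fs.
  have -> : f = 0; last by rewrite !lin0.
  by apply: coeffP => k; apply/eqP/negPn/negP => /fs.
have [d [dk d0]] := delta_ex k.
have -> : f = coeff f k *: d + (f - coeff f k *: d) by rewrite addrC subrK.
rewrite gl hl (gh k) // IH // => k'.
rewrite [coeff _ k'](_ : _ = coeff f k' - coeff f k * coeff d k') //.
have [->|/eqP k'k] := eqVneq k' k; first by rewrite dk mulr1 subrr eqxx.
rewrite (d0 _ k'k) mulr0 subr0 => /fs.
by rewrite inE => /predU1P[].
Qed.

End Free.

Lemma aug_delta (R : pzRingType) (V : lmodType R) (v : V) f :
  is_delta v f -> aug f = v.
Proof.
move=> [fv f0]; rewrite /aug (fsbigTE [fset v]%fset) => [|k]; rewrite ?inE.
  by rewrite big_seq_fset1 -/(coeff f v) fv scale1r.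
by move=> /eqP /f0; rewrite /coeff => ->; rewrite scale0r.
Qed.

(** * Modules and free modules in the model *)

Section Modules.
Variables (U : zfcUniverse) (M : model U).
Implicit Types (x y z a b d u v : U) (E : ctx U) (S T : dclass M).
Notation H := (Hset (height M)).
Notation N := (mset M).
Notation dpred := (dpred M).
Notation dterm := (dterm M).
Notation hval := (@hval U M).
Let lO := height_ord M.

Lemma dop S T (op : S -> T -> T) E (s : E -> S) (t : E -> T) : dset S -> dset T ->
  N (op_code (code S) (code T) op) ->
  dterm (fun e => code S (s e)) -> dterm (fun e => code T (t e)) ->
  dterm (fun e => code T (op (s e) (t e))).
Proof.
move=> hS hT Nop ds dt.
have pinj : injective (fun st : S * T => opair (code S st.1) (code T st.2)).
  by move=> [? ?] [? ?] /= /opair_inj[/code_inj -> /code_inj ->].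
pose P := of_set pinj (dset_prod hS hT).
apply: (@dapp _ M E P T (fun=> (fun st => op st.1 st.2)) (fun e => (s e, t e))).
- exact: dset_prod.
- exact: dterm_cst.
- exact: dterm_opair.
Qed.

Variables (R : pzRingType) (cR : coding U R).

(** What the transfer arguments use of a module in N. Unlike membership of [module_code], it is
    directly inherited by free modules and by kernels of augmentations, hence by the syzygies. *)
Record dmod (V : lmodType R) (c : V -> U) : Prop := DMod {
  dmod_inj : injective c;
  dmod_set : exists X, N X /\ elems X = range c;
  dmodD : forall E (s t : E -> V), dterm (fun e => c (s e)) ->
    dterm (fun e => c (t e)) -> dterm (fun e => c (s e + t e));
  dmodZ : forall E (s : E -> R) (t : E -> V), dterm (fun e => cR (s e)) ->
    dterm (fun e => c (t e)) -> dterm (fun e => c (s e *: t e))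
}.

Definition cls_of (V : lmodType R) (c : V -> U) (h : dmod c) : dclass M :=
  of_set (dmod_inj h) (dmod_set h).

Hypothesis hR : dmod (V := R^o) cR.
Hypothesis RN : forall r, N (cR r).

Let sR := cls_of hR.

Section Linear.
Variables (V W : lmodType R) (cV : V -> U) (cW : W -> U).
Hypotheses (hV : dmod cV) (hW : dmod cW).

Lemma dlinear_at E (f : E -> V -> W) (a : E -> R) (u v : E -> V) :
  dterm (fun e => graph cV cW (f e)) -> dterm (fun e => cR (a e)) ->
  dterm (fun e => cV (u e)) -> dterm (fun e => cV (v e)) ->
  dpred (fun e => f e (a e *: u e + v e) = a e *: f e (u e) + f e (v e)).
Proof.
move=> df da du dv.
have app (t : E -> V) : dterm (fun e => cV (t e)) ->
    dterm (fun e => cW (f e (t e))).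
  move=> dt; exact: (@dapp _ M E (cls_of hV) (cls_of hW) f t (dmod_set hV)).
apply: (@deqS _ M E (cls_of hW)).
  by apply: app; apply: (dmodD hV) => //; apply: (dmodZ hV).
by apply: (dmodD hW); [apply: (dmodZ hW) => //|]; apply: app.
Qed.

Lemma dlinear E (f : E -> V -> W) : dterm (fun e => graph cV cW (f e)) ->
  dpred (fun e => linear (f e)).
Proof.
move=> df.
suff : dpred (fun e : E => forall (a : R) (u v : V),
    f e (a *: u + v) = a *: f e u + f e v) by [].
pose E1 := ext E (code sR); pose E2 := ext E1 (code (cls_of hV)).
apply: (@dall _ M E sR (fun e (a : R) => forall u v : V,
  f e (a *: u + v) = a *: f e u + f e v)).
apply: (@dall _ M E1 (cls_of hV) (fun e (u : V) => forall v : V,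
  f e.1 ((e.2 : R) *: u + v) = (e.2 : R) *: f e.1 u + f e.1 v)).
apply: (@dall _ M E2 (cls_of hV) (fun e (v : V) =>
  f e.1.1 ((e.1.2 : R) *: (e.2 : V) + v) =
  (e.1.2 : R) *: f e.1.1 e.2 + f e.1.1 v)).
apply: (@dlinear_at (ext E2 (code (cls_of hV))) (fun e => f e.1.1.1)).
- exact: (dterm_weak3 df).
- exact: (@dterm_weak2 _ M E1 _ (@dvar _ M E sR)).
- exact: (@dterm_weak _ M E2 _ _ _ (@dvar _ M E1 (cls_of hV))).
- exact: (@dvar _ M E2 (cls_of hV)).
Qed.

End Linear.

Section FreeCode.
Variables (K : choiceType) (c : K -> U).
Hypotheses (c_inj : injective c) (c_set : exists X, N X /\ elems X = range c).
Implicit Types (f : freemod R K) (k : K) (r : R).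

Let sK : dclass M := of_set c_inj c_set.

Lemma in_free f u : u ∈ free_code cR c f <->
  exists k, coeff f k != 0 /\ u = opair (c k) (cR (coeff f k)).
Proof.
rewrite elemsE set_ofE; last first.
  exact/is_set_finite/finite_image/finite_coeff.
by split=> [[k fk <-]|[k [fk ->]]]; exists k.
Qed.

Lemma opair_in_free f k r : opair (c k) (cR r) ∈ free_code cR c f <->
  coeff f k = r /\ r != 0.
Proof.
rewrite in_free; split=> [[k' [fk']]|[<- fk]]; last by exists k.
by move=> /opair_inj[/c_inj -> /(@cd_inj _ _ cR) ->].
Qed.

Lemma free_inj : injective (free_code cR c).
Proof.
move=> f g fg; apply: coeffP => k; apply: contrapT => /eqP nfg.
have [f0|f0] := eqVneq (coeff f k) 0.
  have g0 : coeff g k != 0 by rewrite -f0 eq_sym.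
  have := (opair_in_free g k (coeff g k)).2 (conj erefl g0).
  by rewrite -fg opair_in_free => -[fgk _]; rewrite fgk eqxx in nfg.
have := (opair_in_free f k (coeff f k)).2 (conj erefl f0).
by rewrite fg opair_in_free => -[gf _]; rewrite gf eqxx in nfg.
Qed.

Lemma free_finite f : finite_set (elems (free_code cR c f)).
Proof.
have -> : elems (free_code cR c f) =
    (fun k => opair (c k) (cR (coeff f k))) @` [set k | coeff f k != 0].
  by apply/seteqP; split=> u;
    [move=> /in_free[k [fk ->]]; exists k|move=> [k fk <-]; apply/in_free; exists k].
exact/finite_image/finite_coeff.
Qed.

(** The code is a finite set and all coefficients are in N, so only the support decides. *)
Lemma mset_free f : N (free_code cR c f) <-> forall k, coeff f k != 0 -> N (c k).
Proof.
split=> [Nf k fk|h].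
  have : N (opair (c k) (cR (coeff f k))).
    apply: (finite_sub_mset Nf); first exact: free_finite.
    by apply/opair_in_free.
  by move=> /mset_opair[].
rewrite -[free_code _ _ _]elems_set_of; apply: mset_finite; first exact: free_finite.
by move=> u /in_free[k [fk ->]]; apply/mset_opair; split; [apply: h|apply: RN].
Qed.

Lemma free_set : exists X, N X /\ elems X = range (free_code cR c).
Proof.
have [P [NP PE]] := @dset_prod _ M sK sR c_set (dmod_set hR).
pose F := set_of (finsub (elems P)).
have NF : N F := mset_finsub NP.
have FE : elems F = finsub (elems P) by apply/set_ofE/is_set_finsub.
(* Codes are exactly the finite sets of pairs that are single-valued and omit the coefficient 0. *)
pose good u := u ∈ F /\ ((forall k : sK, forall r r' : sR,
  opair (code sK k) (code sR r) ∈ u -> opair (code sK k) (code sR r') ∈ u -> r = r') /\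
  forall k : sK, ~ opair (code sK k) (cR 0) ∈ u).
have goodP u : good u <-> range (free_code cR c) u.
  split=> [|[f _ <-]]; last first.
    split.
      rewrite elemsE FE; split; first exact: free_finite.
      move=> v /in_free[k [_ ->]]; rewrite PE.
      by exists (k, coeff f k).
    split=> [k r r'|k] /=; last by move=> /opair_in_free[_]; rewrite eqxx.
    by move=> /opair_in_free[<- _] /opair_in_free[<- _].
  rewrite /good elemsE FE => -[[uf uP] [u1 u0]].
  (* The coefficient function read off from u, with value 0 where u has no pair. *)
  have /choice[h hP] k : exists r, forall r', opair (c k) (cR r') ∈ u \/
      r' = 0 /\ (forall r, ~ opair (c k) (cR r) ∈ u) <-> r = r'.
    have [[r kr]|nr] := pselect (exists r, opair (c k) (cR r) ∈ u).
      exists r => r'; split=> [|<-]; last by left.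
      by case=> [kr'|[_ /(_ r)//]]; apply: (u1 k).
    exists 0 => r'; split=> [[kr'|[-> _]//]|<-]; first by case: nr; exists r'.
    by right; split=> // r kr; apply: nr; exists r.
  have hu k : h k != 0 -> opair (c k) (cR (h k)) ∈ u.
    by have [//|[-> _]] := (hP k (h k)).2 erefl; rewrite eqxx.
  have [|f fE] := @mkfree R K h.
    apply: (card_le_finite _ uf); apply/(embedsP u).
    exists (fun k => opair (c k) (cR (h k))); split=> // k k' _ _.
    by move=> /opair_inj[/c_inj].
  exists f => //; apply: elems_inj; apply/seteqP; split=> v.
    by move=> /in_free[k [+ ->]]; rewrite fE => /hu.
  move=> vu; have := uP _ vu; rewrite PE => -[[k r] _ /= vE].
  rewrite -vE; apply/opair_in_free; rewrite fE.
  have kr : opair (c k) (cR r) ∈ u by rewrite vE.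
  split; first by apply/(hP k r); left.
  by apply/eqP => r0; apply: (u0 k); rewrite -r0.
have gE : elems (set_of [set u | good u]) = range (free_code cR c).
  rewrite set_ofE; first by apply/seteqP; split=> u /goodP.
  by apply: (@is_set_sub _ F) => u [].
exists (set_of [set u | good u]); split=> //.
apply: (mset_def (P := good)).
- apply: (Hset_sub lO (mset_sub NF)); rewrite gE.
  by move=> u /goodP[].
- have N0 := RN 0; rewrite /good; definable.
- by move=> u _; rewrite elemsE gE goodP.
Qed.

(** Codes omit zero coefficients, so the value 0 has to be defined separately, by the absence of a
    pair. *)
Lemma dcoeff E (f : E -> freemod R K) (k : E -> K) :
  dterm (fun e => free_code cR c (f e)) -> dterm (fun e => c (k e)) ->
  dterm (fun e => cR (coeff (f e) (k e))).
Proof.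
move=> df dk; apply: dterm_intro => [e|]; first exact: mset_sub (RN _).
have dk1 := dterm_weak hval dk; have df1 := dterm_weak hval df.
have dk2 := dterm_weak hval dk1; have df2 := dterm_weak hval df1.
have N0 := RN 0.
have h : dpred (E := ext E hval) (fun e =>
    opair (c (k e.1)) (hval e.2) ∈ free_code cR c (f e.1) \/
    (hval e.2 = cR 0 /\ forall y, H y -> ~ opair (c (k e.1)) y ∈ free_code cR c (f e.1))).
  by definable.
apply: dpred_eqv h => e; split=> [[|[-> h]]|<-].
- by move=> /in_free[k' [_ /opair_inj[/c_inj -> ->]]].
- congr (cR _); apply/eqP/negPn/negP => fk.
  apply: (h (cR (coeff (f e.1) (k e.1)))); first exact: mset_sub (RN _).
  exact/opair_in_free.
- have [f0|f0] := eqVneq (coeff (f e.1) (k e.1)) 0; [right|left].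
    split; first by rewrite f0.
    by move=> y _ /in_free[k' [fk' /opair_inj[/c_inj kk']]]; rewrite -kk' f0 eqxx in fk'.
  exact/opair_in_free.
Qed.

Let sF : dclass M := of_set free_inj free_set.

Lemma dfree_intro E (f : E -> freemod R K) (g : E -> K -> R) :
  (forall e k, coeff (f e) k = g e k) ->
  dterm (E := ext (ext (ext E hval) (code sF)) (code sK))
    (fun e => cR (g e.1.1.1 e.2)) ->
  dterm (fun e => free_code cR c (f e)).
Proof.
move=> fg dg; apply: dterm_intro => [e|]; first exact: (codeH (d := sF)).
have h : dpred (E := ext E hval) (fun e => exists h : sF,
    (forall k : sK, coeff (h : freemod R K) k = g e.1 k) /\ code sF h = hval e.2).
  apply: dex; apply: dand; last by definable.
  apply: dall; apply: (@deqS _ M _ sR) => //.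
  by apply: dcoeff; definable.
apply: dpred_eqv h => e; split=> [[h [hE <-]]|<-].
  by congr free_code; apply: coeffP => k; rewrite fg hE.
by exists (f e.1); split=> // k; apply: fg.
Qed.

Lemma dmod_free : dmod (free_code cR c).
Proof.
split=> [||E s t ds dt|E s t ds dt]; [exact: free_inj|exact: free_set|..];
  pose E3 := ext (ext (ext E hval) (code sF)) (code sK);
  have dk : dterm (E := E3) (fun e => c e.2) := @dvar _ M _ sK;
  have ds' := dterm_weak3 ds hval (code sF) (code sK);
  have dt' := dterm_weak3 dt hval (code sF) (code sK).
- apply: (@dfree_intro E _ (fun e k => coeff (s e) k + coeff (t e) k)) => //.
  by apply: (dmodD hR); [apply: (dcoeff ds' dk)|apply: (dcoeff dt' dk)].
- apply: (@dfree_intro E _ (fun e k => s e * coeff (t e) k)) => //.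
  by apply: (dmodZ hR) => //; apply: (dcoeff dt' dk).
Qed.

End FreeCode.

End Modules.

(** * Extension by zero along an injection of bases *)

Section Push.
Variables (R : pzRingType) (V' V : choiceType) (i : V' -> V).
Hypothesis i_inj : injective i.

Lemma push_ex (f : freemod R V') : exists g : freemod R V,
  (forall x, coeff g (i x) = coeff f x) /\
  forall v, (forall x, i x <> v) -> coeff g v = 0.
Proof.
have /choice[h hP] v : exists r, (forall x, i x = v -> r = coeff f x) /\
    ((forall x, i x <> v) -> r = 0).
  have [[x <-]|nx] := pselect (exists x, i x = v).
    by exists (coeff f x); split=> [y /i_inj ->//|/(_ x)].
  by exists 0; split=> // x xv; case: nx; exists x.
have [|g gE] := @mkfree R V h.
  apply: sub_finite_set (finite_image i (finite_coeff f)) => v /= hv.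
  have [[x xv]|nx] := pselect (exists x, i x = v).
    by exists x => //=; rewrite -(hP v).1.
  by rewrite (hP v).2 ?eqxx // in hv => x xv; case: nx; exists x.
by exists g; split=> [x|v nv]; rewrite gE; [apply: (hP _).1|apply: (hP _).2].
Qed.

Definition push f := sval (cid (push_ex f)).

Lemma coeff_push f x : coeff (push f) (i x) = coeff f x.
Proof. by rewrite /push; case: cid => g []. Qed.

Lemma coeff_push0 f v : (forall x, i x <> v) -> coeff (push f) v = 0.
Proof. by rewrite /push; case: cid => g [] /= _; apply. Qed.

Lemma push_eqP f g : (forall x, coeff g (i x) = coeff f x) ->
  (forall v, (forall x, i x <> v) -> coeff g v = 0) -> push f = g.
Proof.
move=> h h0; apply: coeffP => v.
have [[x <-]|nx] := pselect (exists x, i x = v); first by rewrite coeff_push h.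
by rewrite coeff_push0 ?h0 // => x xv; apply: nx; exists x.
Qed.

Lemma push_linear : linear push.
Proof.
move=> a f g; apply: push_eqP => [x|v nv].
  by rewrite coeffD coeffZ !coeff_push.
by rewrite coeffD coeffZ !coeff_push0 // mulr0 addr0.
Qed.

Lemma push_inj : injective push.
Proof. by move=> f g fg; apply: coeffP => x; rewrite -!coeff_push fg. Qed.

Lemma push_delta x f : is_delta x f -> is_delta (i x) (push f).
Proof.
move=> [fx f0]; split=> [|v vx]; first by rewrite coeff_push.
have [[y yv]|ny] := pselect (exists y, i y = v).
  by rewrite -yv coeff_push f0 // => yx; apply: vx; rewrite -yv yx.
by rewrite coeff_push0 // => y yv; apply: ny; exists y.
Qed.

Lemma push_onto g : (forall v, coeff g v != 0 -> exists x, i x = v) ->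
  exists f, push f = g.
Proof.
move=> gi; have [|f fE] := @mkfree R V' (fun x => coeff g (i x)).
  apply: card_le_finite (finite_coeff g).
  have [[v0]|nV] := pselect (inhabited V).
    by apply/(embedsP v0); exists i; split=> // x y _ _ /i_inj.
  by rewrite (_ : [set x | _] = set0) // -subset0 => x; case: nV; exists; exact: i x.
exists f; apply: push_eqP => [x|v nv]; first by rewrite fE.
by apply/eqP/negPn/negP => /gi[x]; apply: nv.
Qed.

End Push.

Lemma aug_push (R : pzRingType) (V' V : lmodType R) (i : V' -> V)
    (i_inj : injective i) (f : freemod R V') : linear i ->
  aug (push i_inj f) = i (aug f).
Proof.
move=> il; suff : @aug R V \o push i_inj = i \o @aug R V'.
  by move=> /(congr1 (fun h => h f)).
apply: free_linear_eq => [a u v|a u v|x u ux] /=.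
- by rewrite push_linear linearP.
- by rewrite linearP il.
- by rewrite (aug_delta (push_delta i_inj ux)) (aug_delta ux).
Qed.

(** * Functoriality of the free resolution for injective linear maps *)

Section SyzygyMap.
Variable R : pzRingType.

Definition mono (V' V : lmodType R) := {k : V' -> V | linear k /\ injective k}.

Definition pushm (V' V : lmodType R) (k : mono V' V) :
    freemod R V' -> freemod R V :=
  push (proj2 (svalP k)).

Definition kmod (V : lmodType R) : lmodType R := submod (ker_submod (@aug R V)).

Section Step.
Variables (V' V : lmodType R) (k : mono V' V).

Lemma ker_step_in (x : kmod V') : pushm k (val x) \in ker (@aug R V).
Proof.
have [kl kinj] := svalP k; rewrite inE /ker /=.
rewrite (aug_push _ _ kl); have := valP x; rewrite inE /ker /= => ->.
by have := kl (-1) 0 0; rewrite !scaler0 addr0 scaleN1r addNr.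
Qed.

Definition ker_step (x : kmod V') : kmod V :=
  Submod (ker_submod (@aug R V)) (ker_step_in x).

Lemma ker_step_mono : linear ker_step /\ injective ker_step.
Proof.
split=> [a x y|x y /(congr1 val) xy]; last exact/val_inj/(push_inj xy).
by apply: val_inj; rewrite [LHS](push_linear _ a (val x) (val y)).
Qed.

End Step.

Variables (A' A : lmodType R) (k : mono A' A).

Fixpoint syz_map n : mono (syz A' n) (syz A n) :=
  if n is m.+1 return mono (syz A' n) (syz A n)
  then exist _ _ (ker_step_mono (syz_map m)) else k.

Lemma bdry_push n (f : freemod R (syz A' n.+1)) :
  bdry (pushm (syz_map n.+1) f) = pushm (syz_map n) (bdry f).
Proof.
have [kl _] := svalP (syz_map n.+1).
by rewrite /bdry (aug_push _ _ kl).
Qed.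

End SyzygyMap.

(** * The free resolution in the model *)

Section Augmentation.
Variables (U : zfcUniverse) (M : model U).
Implicit Types (x y z a b d u v : U) (E : ctx U) (S T : dclass M).
Notation N := (mset M).
Notation dterm := (dterm M).
Notation ctx0 := (ctx0 M).
Let lO := height_ord M.
Variables (R : pzRingType) (cR : coding U R).
Notation dmod V c := (@dmod U M R cR V c).

Section Codes.

Lemma coding_set (T : Type) (c : coding U T) : N (set_of (range c)) ->
  exists X, N X /\ elems X = range c.
Proof. by move=> h; exists (set_of (range c)); split=> //; apply/set_ofE/cd_set. Qed.

Lemma dmod_ring : N (ring_code cR) -> dmod (R^o) cR.
Proof.
move=> /mset_opair[Nr /mset_opair[Nadd Nmul]]; have hs := coding_set Nr.
pose S : dclass M := of_set (@cd_inj _ _ cR) hs.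
split=> [||E s t|E s t] //; first exact: cd_inj.
- exact: (@dop _ M S S +%R).
- exact: (@dop _ M S S *%R).
Qed.

Lemma dmod_module (V : lmodType R) (cV : coding U V) : N (ring_code cR) ->
  N (module_code cR cV) -> dmod V cV.
Proof.
move=> /mset_opair[/coding_set hsR _] /mset_opair[/coding_set hs].
move=> /mset_opair[Nadd Nmul].
pose S : dclass M := of_set (@cd_inj _ _ cV) hs.
pose SR : dclass M := of_set (@cd_inj _ _ cR) hsR.
split=> [||E s t|E s t] //; first exact: cd_inj.
- exact: (@dop _ M S S +%R).
- exact: (@dop _ M SR S *:%R).
Qed.

End Codes.

Hypotheses (hR : dmod (R^o) cR) (RN : forall r, N (cR r)).

Section Aug.
Variables (V : lmodType R) (c : V -> U) (hV : dmod V c).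

(** Zero is the only solution of v + v = v. *)
Lemma mset_mod0 : N (c 0).
Proof.
have [||v [Nv v0]] := @internal_ex _ M (cls_of hV) (fun v : V => v + v = v).
- apply: (@deqS _ M _ (cls_of hV)); last exact: dvar.
  by apply: (dmodD hV); apply: (@dvar _ M _ (cls_of hV)).
- by exists 0; rewrite addr0.
by have <- : v = 0 by apply: (addrI v); rewrite v0 addr0.
Qed.

Lemma mset_modP (a : R) (u v : V) : N (c u) -> N (c v) -> N (c (a *: u + v)).
Proof.
move=> Nu Nv; have Na := RN a.
apply: mset_term; apply: (dmodD hV); last exact: dterm_cst.
by apply: (dmodZ hV); apply: dterm_cst.
Qed.

Lemma dmod_freemod : dmod (freemod R V) (free_code cR c).
Proof. exact: (dmod_free hR RN (dmod_inj hV) (dmod_set hV)). Qed.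

Let sV : dclass M := cls_of hV.
Let sF : dclass M := cls_of dmod_freemod.
Let sR : dclass M := cls_of hR.

(** The augmentation is the only linear map that sends each basis vector to its index. This defines
    it without finite sums. *)
Lemma mset_aug : N (graph (free_code cR c) c (@aug R V)).
Proof.
have hSF : dset sF := dmod_set dmod_freemod; have hSV : dset sV := dmod_set hV.
have N0 := RN 0; have N1 := RN 1.
have [||g [Ng [gl gd]]] := @internal_ex _ M (arr hSF hSV) (fun g : freemod R V -> V =>
  linear g /\ forall (v : sV) (f : sF), (coeff (f : freemod R V) v = 1 /\
    forall v' : sV, v' <> v -> coeff (f : freemod R V) v' = 0) -> g f = v).
- apply: dand.
    apply: (dlinear hR dmod_freemod hV).
    exact: (@dvar _ M ctx0 (arr hSF hSV)).
  pose E1 := ext ctx0 (code (arr hSF hSV)); pose E2 := ext E1 (code sV).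
  pose E3 := ext E2 (code sF); pose E4 := ext E3 (code sV).
  apply: (@dall _ M E1 sV); apply: (@dall _ M E2 sF); apply: dimp.
    apply: dand.
      apply: (@deqS _ M E3 sR); last by definable.
      by apply: (dcoeff RN (dmod_inj hV)); definable.
    apply: (@dall _ M E3 sV); apply: dimp; first by definable.
    apply: (@deqS _ M E4 sR); last by definable.
    by apply: (dcoeff RN (dmod_inj hV)); definable.
  apply: (@deqS _ M E3 sV); last by definable.
  by apply: (@dapp _ M E3 sF sV (fun e => e.1.1.2) (fun e => e.2)) => //; definable.
- exists (@aug R V); split; first exact: aug_linear.
  by move=> v f fv; apply: aug_delta; case: fv.
suff <- : g = @aug R V by [].
apply: free_linear_eq => //; first exact: aug_linear.
by move=> v f fv; rewrite (aug_delta fv); apply: gd; case: fv.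
Qed.

Lemma daug E (f : E -> freemod R V) : dterm (fun e => free_code cR c (f e)) ->
  dterm (fun e => c (aug (f e))).
Proof.
move=> df; apply: (@dapp _ M E sF sV (fun=> @aug R V) f) => //.
  exact: (dmod_set dmod_freemod).
exact/dterm_cst/mset_aug.
Qed.

Let ker_code (x : submod (ker_submod (@aug R V))) := free_code cR c (val x).

Lemma dmod_ker : dmod _ ker_code.
Proof.
have [X [NX XE]] := dmod_set dmod_freemod.
split=> [x y||E s t ds dt|E s t ds dt].
- by move/(dmod_inj dmod_freemod)/val_inj.
- pose good u := exists f : sF, code sF f = u /\ aug (f : freemod R V) = 0.
  have gE : elems (set_of [set u | good u]) = [set u | good u].
    apply/set_ofE/(@is_set_sub _ X) => u [f [<- _]].
    by rewrite XE; exists f.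
  exists (set_of [set u | good u]); split.
    apply: (mset_def (P := good)).
    + apply: (Hset_sub lO (mset_sub NX)); rewrite gE XE => u [f [<- _]].
      by exists f.
    + have N0 := mset_mod0; apply: dex; apply: dand; first by definable.
      apply: (@deqS _ M _ sV); last exact: dterm_cst.
      by apply: daug; apply: (@dvar _ M _ sF).
    + by move=> u _; rewrite elemsE gE.
  rewrite gE; apply/seteqP; split=> [u [f [<- f0]]|_ [x _ <-]].
    have fK : f \in ker (@aug R V) by rewrite inE.
    by exists (Submod (ker_submod (@aug R V)) fK).
  by exists (val x); split=> //; have := valP x; rewrite inE.
- exact: (dmodD dmod_freemod ds dt).
- exact: (dmodZ dmod_freemod ds dt).
Qed.

End Aug.

Lemma dmod_syz (A : lmodType R) (cA : coding U A) n : dmod A cA ->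
  dmod (syz A n) (@syz_code U R cR A cA n).
Proof. by move=> hA; elim: n => [|n IH] //=; apply: dmod_ker. Qed.

End Augmentation.

(** * Transfer of cocycles *)

Definition to_linear (R : pzRingType) (V W : lmodType R) (f : V -> W)
    (fl : linear f) : {linear V -> W} :=
  HB.pack f (GRing.isLinear.Build R V W *:%R f fl).

Section ExtClasses.
Variables (R : pzRingType) (A B : lmodType R).

(** Stated for arbitrary functions, so that it can occur in formulas quantifying over all maps. *)
Definition cohom n (f g : freemod R (syz A n) -> B) :=
  @is_coboundary R A B n (f \- g).

Lemma ext_classP n (z w : cocycle A B n) :
  ext_class z = ext_class w <-> cohom (val z) (val w).
Proof.
have e : (z - w \in @coboundary R A B n) = `[< cohom (val z) (val w) >] by [].
rewrite /ext_class; split=> [/eqP|h].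
  by rewrite -Quotient.idealrBE e => /asboolP.
by apply/eqP; rewrite -Quotient.idealrBE e; apply/asboolP.
Qed.

Lemma ext_class_ex n (c : Ext A B n) : exists z : cocycle A B n, ext_class z = c.
Proof. by exists (repr c); rewrite /ext_class reprK. Qed.

Lemma ext_classB n (z w : cocycle A B n) :
  ext_class (z - w) = ext_class z - ext_class w.
Proof. by rewrite /ext_class raddfB. Qed.

Lemma mk_cocycle n (f : freemod R (syz A n) -> B) : @is_cocycle R A B n f ->
  exists z : cocycle A B n, val z = f.
Proof.
move=> hf; have fK : f \in @is_cocycle R A B n by rewrite inE.
by exists (Subgrp (@cocycle_zmod R A B n) fK).
Qed.

Lemma cocycleP n (z : cocycle A B n) : @is_cocycle R A B n (val z).
Proof. by have := valP z; rewrite inE. Qed.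

Lemma cohom0P (f g : freemod R (syz A 0) -> B) : cohom f g <-> forall u, f u = g u.
Proof.
rewrite /cohom /=; split=> [fg u|fg].
  by apply/subr0_eq; have := congr1 (fun h => h u) fg.
by apply/funext => u; rewrite /= fg subrr.
Qed.

Lemma cohomSP n (f g : freemod R (syz A n.+1) -> B) : cohom f g <->
  exists h : freemod R (syz A n) -> B, linear h /\
    forall u, f u = g u + h (bdry u).
Proof.
rewrite /cohom /=; split=> [[h fg]|[h [hl fg]]].
  exists h; split; first exact: linearP.
  by move=> u; have := congr1 (fun h => h u) fg; rewrite /= => <-; rewrite addrC subrK.
exists (to_linear hl); apply/funext => u.
by rewrite /= fg addrC addKr.
Qed.

Lemma cocycle_linear n (f : freemod R (syz A n) -> B) :
  @is_cocycle R A B n f <->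
  linear f /\ forall u : freemod R (syz A n.+1), f (bdry u) = 0.
Proof.
split=> -[fl fb]; split=> //; last exact/funext.
by move=> u; have := congr1 (fun h => h u) fb.
Qed.

End ExtClasses.

(** * Lifting and restricting maps between traces *)

Section Transfer.
Variables (U : zfcUniverse) (M : model U).
Implicit Types (E : ctx U) (S T : dclass M).
Notation H := (Hset (height M)).
Notation N := (mset M).
Notation dpred := (dpred M).
Notation dterm := (dterm M).
Notation ctx0 := (ctx0 M).
Notation hval := (@hval U M).
Let lO := height_ord M.
Let Htrans := Hset_transitive lO.
Variables (R : pzRingType) (cR : coding U R).
Notation dmod V c := (@dmod U M R cR V c).
Hypotheses (hR : dmod (R^o) cR) (RN : forall r, N (cR r)).

(** V' is a copy of the trace of V. Leaving the copy arbitrary covers submodules, their syzygies,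
    and a module contained in N with the identity. *)
Definition onto_trace (V' V : lmodType R) (k : mono V' V) (c : V -> U) :=
  forall v, N (c v) <-> exists x, sval k x = v.

Definition push_mono (V' V : lmodType R) (k : mono V' V) :
    mono (freemod R V') (freemod R V) :=
  exist _ (pushm k) (conj (push_linear _) (@push_inj _ _ _ _ _)).

Lemma onto_push (V' V : lmodType R) (k : mono V' V) c (hV : dmod V c) :
  onto_trace k c -> onto_trace (push_mono k) (free_code cR c).
Proof.
move=> kc f; rewrite (mset_free RN (dmod_inj hV)).
split=> [fN|[g <-] v].
  by apply: push_onto => v /fN /kc.
have [[x <-] _|nx] := pselect (exists x, sval k x = v); first by apply/kc; exists x.
by rewrite /= coeff_push0 ?eqxx // => x xv; apply: nx; exists x.
Qed.

(** Induction on n. An element of the next syzygy that lies in N has its support in N, so it is the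
    push of some f; its augmentation vanishes, and so does that of f by injectivity. *)
Lemma onto_syz (A' A : lmodType R) (k : mono A' A) (cA : coding U A) n :
  dmod A cA -> onto_trace k cA ->
  onto_trace (syz_map k n) (@syz_code U R cR A cA n).
Proof.
move=> hA kc; elim: n => [//|n IH] v.
rewrite /= (onto_push (dmod_syz hR RN n hA) IH (val v)).
split=> [[f fv]|[x <-]]; last by exists (val x).
have fK : f \in ker (@aug R (syz A' n)).
  have [kl kinj] := svalP (syz_map k n).
  rewrite inE /ker /=; apply: (kinj); rewrite -(aug_push (proj2 (svalP (syz_map k n))) f kl).
  rewrite [push _ _]fv; have := valP v; rewrite inE /ker /= => ->.
  by have := kl (-1) 0 0; rewrite !scaler0 addr0 scaleN1r addNr.
exists (Submod (ker_submod (@aug R (syz A' n))) fK).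
exact: val_inj.
Qed.

Section LiftModules.
Variables (V' V W' W : lmodType R) (k : mono V' V) (l : mono W' W).
Variables (c : V -> U) (d : W -> U).
Hypotheses (hV : dmod V c) (hW : dmod W d).
Hypotheses (kc : onto_trace k c) (ld : onto_trace l d).

Definition lifts (f : V' -> W') (g : V -> W) :=
  N (graph c d g) /\ forall x, g (sval k x) = sval l (f x).

Lemma mset_dom x : N (c (sval k x)).
Proof. by apply/kc; exists x. Qed.

Lemma lifts_restrict g : N (graph c d g) -> exists f, lifts f g.
Proof.
move=> Ng; have /choice[f fP] x : exists y, sval l y = g (sval k x).
  apply/ld; apply: (@mset_app _ M (cls_of hV) (cls_of hW)) => //.
    exact: dmod_set hV.
  exact: mset_dom.
by exists f; split=> // x; rewrite fP.
Qed.

Lemma lifts_unique f g g' : lifts f g -> lifts f g' -> g = g'.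
Proof.
move=> [Ng gf] [Ng' g'f].
apply: (@internal_graph_eq _ M (cls_of hV) (cls_of hW)) => //.
- exact: dmod_set hV.
- exact: dmod_set hW.
- by move=> v /kc[x <-]; rewrite gf g'f.
Qed.

(** Every scalar a is in N and can be fixed as a parameter; elementarity then extends the identity
    from N in u and v, one variable at a time. *)
Lemma lifts_linear f g : lifts f g -> (linear f <-> linear g).
Proof.
move=> [Ng gf]; have [kl kinj] := svalP k; have [ll linj] := svalP l.
split=> [fl|gl] a; last first.
  by move=> x y; apply: linj; rewrite -gf kl gl !gf ll.
have Na := RN a.
apply: (@internal_all _ M (cls_of hV) (fun u => forall v, g (a *: u + v) = a *: g u + g v)).
  apply: (@dall _ M _ (cls_of hV)).
  apply: (@dlinear_at _ M _ _ _ _ _ _ hV hW _ (fun=> g) (fun=> a)).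
  - exact: dterm_cst.
  - exact: dterm_cst.
  - exact: (@dterm_weak _ M (ext ctx0 (code (cls_of hV))) _ _ _
      (@dvar _ M ctx0 (cls_of hV))).
  - exact: (@dvar _ M (ext ctx0 (code (cls_of hV))) (cls_of hV)).
move=> u Nu; apply: (@internal_all _ M (cls_of hV)).
  apply: (@dlinear_at _ M _ _ _ _ _ _ hV hW _ (fun=> g) (fun=> a) (fun=> u)).
  - exact: dterm_cst.
  - exact: dterm_cst.
  - exact: dterm_cst.
  - exact: (@dvar _ M ctx0 (cls_of hV)).
move=> v /kc[y <-]; have [x <-] := (kc u).1 Nu.
by rewrite -kl !gf fl ll.
Qed.

Hypothesis guess : guesses M.

Lemma lifts_ex f : exists g, lifts f g.
Proof.
have [_ kinj] := svalP k.
(* The map f transported to the trace of V, with default value 0 outside it. *)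
have /choice[h hP] v : exists w, forall x, sval k x = v -> w = sval l (f x).
  have [[x <-]|nx] := pselect (exists x, sval k x = v).
    by exists (sval l (f x)) => y /kinj ->.
  by exists 0 => x xv; case: nx; exists x.
have [|g [Ng gP]] := @internal_lift _ M guess (cls_of hV) (cls_of hW) h
  (dmod_set hV) (dmod_set hW).
  by move=> v /kc[x xv]; rewrite (hP _ _ xv); apply/ld; exists (f x).
exists g; split=> // x; rewrite gP; last exact: mset_dom.
exact: hP.
Qed.

End LiftModules.

Section ExtTransfer.
Variables (A' A B' B : lmodType R) (kA : mono A' A) (kB : mono B' B).
Variables (cA : coding U A) (cB : coding U B).
Hypotheses (hA : dmod A cA) (hB : dmod B cB).
Hypotheses (kcA : onto_trace kA cA) (kcB : onto_trace kB cB).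

Let fcode n := free_code cR (@syz_code U R cR A cA n).
Let hS n : dmod _ (@syz_code U R cR A cA n) := dmod_syz hR RN n hA.
Let hF n : dmod _ (@fcode n) := dmod_freemod hR RN (hS n).
Let J n := push_mono (syz_map kA n).
Let Jtrace n : onto_trace (J n) (@fcode n) :=
  onto_push (hS n) (onto_syz (n := n) hA kcA).
Let arrF n : dclass M :=
  @arr _ M (cls_of (hF n)) (cls_of hB) (dmod_set (hF n)) (dmod_set hB).

Lemma dbdry n E (u : E -> freemod R (syz A n.+1)) :
  dterm (fun e => @fcode n.+1 (u e)) -> dterm (fun e => @fcode n (bdry (u e))).
Proof. exact: (daug hR RN (hS n.+1)). Qed.

Lemma dfun_app n E (f : E -> freemod R (syz A n) -> B) (u : E -> freemod R (syz A n)) :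
  dterm (fun e => graph (@fcode n) cB (f e)) -> dterm (fun e => @fcode n (u e)) ->
  dterm (fun e => cB (f e (u e))).
Proof. exact: (@dapp _ M E (cls_of (hF n)) (cls_of hB) f u (dmod_set (hF n))). Qed.

Lemma dcocycle n E (f : E -> freemod R (syz A n) -> B) :
  dterm (fun e => graph (@fcode n) cB (f e)) ->
  dpred (fun e => @is_cocycle R A B n (f e)).
Proof.
move=> df; apply: (dpred_eqv (P := fun e => linear (f e) /\
    forall u : cls_of (hF n.+1), f e (bdry (u : freemod R (syz A n.+1))) = 0)).
  by move=> e; rewrite cocycle_linear.
apply: dand; first exact: (dlinear hR (hF n) hB).
have N0 := mset_mod0 hB.
apply: (@dall _ M E (cls_of (hF n.+1))
  (fun e u => f e (bdry (u : freemod R (syz A n.+1))) = 0)).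
apply: (@deqS _ M _ (cls_of hB)); last exact: dterm_cst.
apply: (@dfun_app n (ext E (code (cls_of (hF n.+1)))) (fun e => f e.1)).
  exact: (dterm_weak _ df).
by apply: dbdry; apply: (@dvar _ M E (cls_of (hF n.+1))).
Qed.

Lemma dcohom n E (f g : E -> freemod R (syz A n) -> B) :
  dterm (fun e => graph (@fcode n) cB (f e)) ->
  dterm (fun e => graph (@fcode n) cB (g e)) ->
  dpred (fun e => cohom (f e) (g e)).
Proof.
case: n f g => [|n] f g df dg.
  apply: (dpred_eqv (P := fun e => forall u : cls_of (hF 0), f e u = g e u)).
    by move=> e; rewrite cohom0P.
  apply: (@dall _ M E (cls_of (hF 0)) (fun e u => f e u = g e u)).
  have dv := @dvar _ M E (cls_of (hF 0)); pose E1 := ext E (code (cls_of (hF 0))).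
  apply: (@deqS _ M E1 (cls_of hB)).
    exact: (@dfun_app 0 E1 (fun e => f e.1) _ (dterm_weak _ df) dv).
  exact: (@dfun_app 0 E1 (fun e => g e.1) _ (dterm_weak _ dg) dv).
apply: (dpred_eqv (P := fun e => exists h : arrF n, linear (h : freemod R (syz A n) -> B) /\
    forall u : cls_of (hF n.+1),
      f e u = g e u + (h : freemod R (syz A n) -> B) (bdry (u : freemod R (syz A n.+1))))).
  by move=> e; rewrite cohomSP.
pose E1 := ext E (code (arrF n)); pose E2 := ext E1 (code (cls_of (hF n.+1))).
have dh : dterm (E := E1) (fun e => graph (@fcode n) cB (e.2 : freemod R (syz A n) -> B)).
  exact: (@dvar _ M E (arrF n)).
apply: (@dex _ M E (arrF n)); apply: dand; first exact: (dlinear hR (hF n) hB).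
have du := @dvar _ M E1 (cls_of (hF n.+1)).
apply: (@dall _ M E1 (cls_of (hF n.+1))).
apply: (@deqS _ M E2 (cls_of hB)).
  exact: (@dfun_app n.+1 E2 (fun e => f e.1.1) _ (dterm_weak2 df _ _) du).
apply: (dmodD hB).
  exact: (@dfun_app n.+1 E2 (fun e => g e.1.1) _ (dterm_weak2 dg _ _) du).
apply: (@dfun_app n E2 (fun e => e.1.2)); first exact: (dterm_weak _ dh).
exact: dbdry.
Qed.

Notation lifts n := (@lifts _ _ _ _ (J n) kB (@fcode n) cB).

(** Boundaries commute with the inclusions of traces, so the two cocycle equations agree at points
    of N, and elementarity gives the rest. *)
Lemma lifts_cocycle n f g : lifts n f g ->
  (@is_cocycle R A' B' n f <-> @is_cocycle R A B n g).
Proof.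
move=> fg; rewrite !cocycle_linear (lifts_linear (hF n) hB (@Jtrace n) fg).
have [Ng gf] := fg; have [ll linj] := svalP kB.
have l0 : sval kB 0 = 0.
  by have := ll (-1) 0 0; rewrite !scaler0 addr0 scaleN1r addNr.
split=> -[gl h]; split=> // u; last first.
  apply: linj; rewrite -gf l0 -(h (sval (J n.+1) u)).
  by congr g; rewrite /= -bdry_push.
have N0 := mset_mod0 hB; move: u.
apply: (@internal_all _ M (cls_of (hF n.+1))).
  apply: (@deqS _ M _ (cls_of hB)); last exact: dterm_cst.
  apply: (@dfun_app n _ (fun=> g)); first exact: dterm_cst.
  by apply: dbdry; apply: (@dvar _ M ctx0 (cls_of (hF n.+1))).
by move=> u /(@Jtrace n.+1)[x <-]; rewrite [bdry _]bdry_push gf h l0.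
Qed.

Hypothesis guess : guesses M.

(** A cochain witnessing cohomology over the traces is lifted to N. Conversely, if a witness exists
    over A and B, one exists in N by elementarity, and its restriction is a witness over the
    traces. *)
Lemma lifts_cohom n f f' g g' : lifts n f g -> lifts n f' g' ->
  (cohom f f' <-> cohom g g').
Proof.
have [ll linj] := svalP kB.
have lD u v : sval kB (u + v) = sval kB u + sval kB v.
  by have := ll 1 u v; rewrite !scale1r.
case: n f f' g g' => [|n] f f' g g' [Ng gf] [Ng' gf'].
  rewrite !cohom0P; split=> h u; last by apply: linj; rewrite -gf -gf' h.
  move: u; apply: (@internal_all _ M (cls_of (hF 0))).
    have dv := @dvar _ M ctx0 (cls_of (hF 0)).
    apply: (@deqS _ M _ (cls_of hB)).
      by apply: (@dfun_app 0 _ (fun=> g)) => //; apply: dterm_cst.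
    by apply: (@dfun_app 0 _ (fun=> g')) => //; apply: dterm_cst.
  by move=> u /(@Jtrace 0)[x <-]; rewrite gf gf' h.
rewrite !cohomSP; split=> [[h [hl hf]]|].
  have [k [Nk kh]] := lifts_ex (hF n) hB (@Jtrace n) kcB guess h.
  have kl := (lifts_linear (hF n) hB (@Jtrace n) (conj Nk kh)).1 hl.
  exists k; split=> // u; move: u.
  apply: (@internal_all _ M (cls_of (hF n.+1))).
    have dv := @dvar _ M ctx0 (cls_of (hF n.+1)).
    apply: (@deqS _ M _ (cls_of hB)).
      by apply: (@dfun_app n.+1 _ (fun=> g)) => //; apply: dterm_cst.
    apply: (dmodD hB).
      by apply: (@dfun_app n.+1 _ (fun=> g')) => //; apply: dterm_cst.
    by apply: (@dfun_app n _ (fun=> k)); [apply: dterm_cst|apply: dbdry].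
  by move=> u /(@Jtrace n.+1)[x <-]; rewrite [bdry _]bdry_push gf gf' kh hf lD.
move=> hex; have [||k [Nk [kl kg]]] := @internal_ex _ M (arrF n) (fun h =>
    linear (h : freemod R (syz A n) -> B) /\ forall u : cls_of (hF n.+1),
    g u = g' u + (h : freemod R (syz A n) -> B) (bdry (u : freemod R (syz A n.+1)))).
- pose E1 := ext ctx0 (code (arrF n)); pose E2 := ext E1 (code (cls_of (hF n.+1))).
  have dh : dterm (E := E1) (fun e => graph (@fcode n) cB (e.2 : freemod R (syz A n) -> B)).
    exact: (@dvar _ M ctx0 (arrF n)).
  apply: dand; first exact: (dlinear hR (hF n) hB).
  apply: (@dall _ M E1 (cls_of (hF n.+1))).
  have du := @dvar _ M E1 (cls_of (hF n.+1)).
  apply: (@deqS _ M E2 (cls_of hB)).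
    by apply: (@dfun_app n.+1 E2 (fun=> g)) => //; apply: dterm_cst.
  apply: (dmodD hB).
    by apply: (@dfun_app n.+1 E2 (fun=> g')) => //; apply: dterm_cst.
  apply: (@dfun_app n E2 (fun e => e.1.2)); first exact: (dterm_weak _ dh).
  exact: dbdry.
- by case: hex => h [hl hg]; exists h.
have [h hk] := lifts_restrict (hF n) hB (@Jtrace n) kcB Nk.
exists h; split; first exact/(lifts_linear (hF n) hB (@Jtrace n) hk).
move=> x; apply: linj; rewrite -gf lD -gf' -(proj2 hk) (kg (sval (J n.+1) x)).
by congr (_ + k _); apply: bdry_push.
Qed.

(** The difference of g and g' is in N as the only h with h + g' = g, an equation that uses addition
    alone. *)
Lemma lifts_sub n f f' g g' : lifts n f g -> lifts n f' g' ->
  lifts n (f \- f') (g \- g').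
Proof.
move=> [Ng gf] [Ng' gf']; have [ll linj] := svalP kB.
have [||h [Nh hg]] := @internal_ex _ M (arrF n) (fun h => forall u : cls_of (hF n),
    (h : freemod R (syz A n) -> B) u + g' u = g u).
- pose E1 := ext ctx0 (code (arrF n)); pose E2 := ext E1 (code (cls_of (hF n))).
  apply: (@dall _ M E1 (cls_of (hF n))).
  have du := @dvar _ M E1 (cls_of (hF n)).
  apply: (@deqS _ M E2 (cls_of hB)); last first.
    by apply: (@dfun_app n E2 (fun=> g)) => //; apply: dterm_cst.
  apply: (dmodD hB); last first.
    by apply: (@dfun_app n E2 (fun=> g')) => //; apply: dterm_cst.
  apply: (@dfun_app n E2 (fun e => e.1.2)) => //.
  exact: (dterm_weak _ (@dvar _ M ctx0 (arrF n))).
- by exists (g \- g') => u /=; rewrite subrK.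
have hE : (h : freemod R (syz A n) -> B) = g \- g'.
  by apply/funext => u /=; rewrite -hg addrK.
split; first by rewrite -hE.
move=> x /=; rewrite gf gf'.
have := ll (-1) (f' x) (f x); rewrite !scaleN1r => lB.
by rewrite [f x - _]addrC lB addrC.
Qed.

Let L n (z : cocycle A' B' n) : {w : cocycle A B n | lifts n (val z) (val w)}.
Proof.
apply/cid; have [g zg] := lifts_ex (hF n) hB (@Jtrace n) kcB guess (val z).
have [w wg] := mk_cocycle ((lifts_cocycle zg).1 (cocycleP z)).
by exists w; rewrite wg.
Qed.

Let lift n (z : cocycle A' B' n) := sval (L z).

Let ext_class_lift n (z w : cocycle A' B' n) :
  ext_class (lift z) = ext_class (lift w) <-> ext_class z = ext_class w.
Proof. by rewrite !ext_classP (lifts_cohom (svalP (L z)) (svalP (L w))). Qed.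

(** A class goes to the class of the lift of a representative. [lifts_cohom] makes this well defined
    and injective, and uniqueness of lifts makes it additive. Each cocycle in N is the lift of its
    restriction, which gives the range. *)
Theorem ext_iso n : exists2 phi : {additive Ext A' B' n -> Ext A B n},
  injective phi & range phi = @ext_trace U R cR A B cA cB N n.
Proof.
pose phi (c : Ext A' B' n) : Ext A B n := ext_class (lift (repr c)).
have reprE (c : Ext A' B' n) : ext_class (repr c) = c by rewrite /ext_class reprK.
have phiE z : phi (ext_class z) = ext_class (lift z).
  by apply/ext_class_lift; rewrite reprE.
have phiB : zmod_morphism phi.
  move=> c c'; have [z <-] := ext_class_ex c; have [w <-] := ext_class_ex c'.
  rewrite -ext_classB !phiE -ext_classB.
  have zw := lifts_sub (svalP (L z)) (svalP (L w)).
  congr ext_class; apply: val_inj.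
  exact: (lifts_unique (hF n) hB (@Jtrace n) (svalP (L (z - w))) zw).
pose Phi : {additive Ext A' B' n -> Ext A B n} :=
  HB.pack phi (GRing.isZmodMorphism.Build _ _ phi phiB).
exists Phi.
  move=> c c'; have [z <-] := ext_class_ex c; have [w <-] := ext_class_ex c'.
  by rewrite /= !phiE => /ext_class_lift.
apply/seteqP; split=> [_ [c _ <-]|_ [w Nw <-]].
  exists (lift (repr c)) => //; exact: (svalP (L (repr c))).1.
have [f fw] := lifts_restrict (hF n) hB (@Jtrace n) kcB Nw.
have [z zf] := mk_cocycle ((lifts_cocycle fw).2 (cocycleP w)).
exists (ext_class z) => //; rewrite /= phiE; congr ext_class; apply: val_inj.
have lz : lifts n f (val (lift z)) by rewrite -zf; exact: (svalP (L z)).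
exact: (lifts_unique (hF n) hB (@Jtrace n) lz fw).
Qed.

(** One direction is injectivity of [ext_iso]. For the other, a nonzero class need not itself be in
    the trace, but elementarity replaces it by the class of a cocycle in N that is still not a
    coboundary. *)
Lemma ext_zero n : (forall c : Ext A B n, c = 0) <->
  (forall c : Ext A' B' n, c = 0).
Proof.
have [phi phi_inj phiE] := ext_iso n.
split=> h c; first by apply: phi_inj; rewrite [LHS]h [RHS]h.
apply: contrapT => c0; have [z zc] := ext_class_ex c.
pose SE := arrF n.
(* The zero cochain is a parameter of the formula used below. *)
have N0 : N (graph (@fcode n) cB (fun=> 0)).
  have [||g [Ng g0]] := @internal_ex _ M SE (fun g => forall u : cls_of (hF n),
    (g : freemod R (syz A n) -> B) u = 0).
  - have N0 := mset_mod0 hB; pose E1 := ext ctx0 (code SE).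
    pose E2 := ext E1 (code (cls_of (hF n))).
    apply: (@dall _ M E1 (cls_of (hF n))).
    apply: (@deqS _ M E2 (cls_of hB)); last exact: dterm_cst.
    apply: (@dfun_app n E2 (fun e => e.1.2)); last exact: (@dvar _ M E1 (cls_of (hF n))).
    exact: (dterm_weak _ (@dvar _ M ctx0 SE)).
  - by exists (fun=> 0).
  by rewrite (_ : (fun=> 0) = g) //; apply/funext => u; rewrite g0.
have [||g [Ng [gc g0]]] := @internal_ex _ M SE (fun g =>
    @is_cocycle R A B n g /\ ~ cohom (g : freemod R (syz A n) -> B) (fun=> 0)).
- have dg := @dvar _ M ctx0 SE; apply: dand; first exact: dcocycle.
  apply: dnot; apply: (@dcohom n (ext ctx0 (code SE)) (fun e => e.2) (fun=> fun=> 0)) => //.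
  exact: dterm_cst.
- exists (val z); split; first exact: cocycleP.
  move=> z0; apply: c0; rewrite -zc.
  have -> : 0 = ext_class (0 : cocycle A B n) by rewrite /ext_class raddf0.
  exact/ext_classP.
have [w wg] := mk_cocycle gc; apply: g0; rewrite -wg.
have : range phi (ext_class w) by rewrite phiE; exists w => //; rewrite /= /cocycle_code wg.
move=> [c' _]; rewrite (h c') raddf0 => w0.
apply/(@ext_classP _ _ _ _ w 0); rewrite -w0 /ext_class; exact/esym/raddf0.
Qed.

Lemma mem_ext_code n (c : Ext A B n) y : y ∈ ext_code cR cA cB c <->
  exists z, ext_class z = c /\ cocycle_code cR cA cB z = y.
Proof.
rewrite elemsE set_ofE; first by split=> [[z zc <-]|[z [zc <-]]]; exists z.
have [X [NX XE]] := dmod_set (hF n); have [Y [NY YE]] := dmod_set hB.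
apply: (@is_set_powerset _ (pairs X Y)) => _ [z _ <-] u.
move=> /(@in_graph _ M (cls_of (hF n)) (cls_of hB) _ (dmod_set (hF n)))[s ->].
by apply: opair_pairs; rewrite elemsE ?XE ?YE; [exists s|exists (val z s)].
Qed.

(** A class in N has an element in N by elementarity. Conversely the class is definable from any
    cocycle z in it, as the set of cocycles cohomologous to z. *)
Lemma mset_ext_code n (c : Ext A B n) : H (ext_code cR cA cB c) ->
  N (ext_code cR cA cB c) <-> @ext_trace U R cR A B cA cB N n c.
Proof.
move=> Hc; split=> [Nc|[z Nz zc]].
  have [||y [Ny /mem_ext_code[z [zc zy]]]] := @mset_ex _ M (fun y => y ∈ ext_code cR cA cB c).
  - by definable.
  - have [z zc] := ext_class_ex c; exists (cocycle_code cR cA cB z).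
    have zin : cocycle_code cR cA cB z ∈ ext_code cR cA cB c.
      by apply/mem_ext_code; exists z.
    by split=> //; apply: Htrans zin.
  by exists z => //; rewrite /= zy.
apply: (mset_def (P := fun y => exists g : arrF n, (@is_cocycle R A B n g /\
    cohom (g : freemod R (syz A n) -> B) (val z)) /\ code (arrF n) g = y)) => //.
  have dg := @dvar _ M (ext ctx0 hval) (arrF n).
  apply: dex; apply: dand; last by definable.
  apply: dand; first exact: dcocycle.
  by apply: (@dcohom n (ext (ext ctx0 hval) (code (arrF n))) (fun e => e.2) (fun=> val z))
    => //; apply: dterm_cst.
move=> y _; rewrite mem_ext_code; split=> [[w [wc <-]]|[g [[gc gz] <-]]].
  exists (val w); split=> //; split; first exact: cocycleP.
  by apply/ext_classP; rewrite wc zc.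
have [w wg] := mk_cocycle gc; exists w; split; last by rewrite /cocycle_code wg.
by rewrite -zc; apply/ext_classP; rewrite wg.
Qed.

End ExtTransfer.

End Transfer.

(** * The traces of A and B as submodules *)

Lemma submod_val_mono (R : pzRingType) (V : lmodType R) (P : set V)
    (h : submod_closed (mem P)) :
  linear (val : submod h -> V) /\ injective (val : submod h -> V).
Proof. by split=> [a x y|]; [|exact: val_inj]. Qed.

Theorem lemma3p1 (U : zfcUniverse) (kappa lambda : U)
    (kappa_reg : regular_uncountable_cardinal kappa)
    (lambda_card : is_cardinal lambda)
    (kappa_le_lambda : elems kappa `<=` elems lambda)
    (R : pzRingType) (cR : coding U R) (R_small : card_lt [set: R] kappa)
    (A B : lmodType R) (cA : coding U A) (cB : coding U B)
    (N : set U) (N_Pstar : Pstar kappa lambda N)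
    (N_guess : zero_guessing lambda N)
    (R_N : N (ring_code cR))
    (A_N : N (module_code cR cA)) (B_N : N (module_code cR cB)) :
  exists (hA : submod_closed (mem (trace cA N)))
         (hB : submod_closed (mem (trace cB N))),
    let NA : lmodType R := submod hA in
    let NB : lmodType R := submod hB in
    [/\ forall n : nat,
          [/\ exists2 phi : {additive Ext NA NB n -> Ext A B n},
                injective phi & range phi = @ext_trace U R cR A B cA cB N n,
              forall c : Ext A B n, Hset lambda (ext_code cR cA cB c) ->
                (N (ext_code cR cA cB c) <-> ext_trace cR cA cB N c)
            & (forall c : Ext A B n, c = 0) <->
              (forall c : Ext NA NB n, c = 0)],
        forall phi : {linear NA -> NB},
          exists psi : {linear A -> B}, forall x : NA, psi (val x) = val (phi x)
      & (forall b : B, N (cB b)) ->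
        forall phi : {linear NA -> B},
          exists psi : {linear A -> B}, forall x : NA, psi (val x) = phi x].
Proof.
have [[kO _] _ kappa_unctbl] := kappa_reg; have [lO _] := lambda_card.
have lN : ~ countable (elems lambda).
  by move=> /(sub_countable (subset_card_le kappa_le_lambda)).
have [_ N_ord N_elem] := N_Pstar.
pose M := Model lO lN N_elem R_N.
have hR : dmod M cR (V := R^o) cR by apply: dmod_ring.
have RN : forall r, mset M (cR r).
  exact: (@mset_all _ M (cls_of hR) kappa (dmod_set hR) kO kappa_le_lambda N_ord).
have hA : dmod M cR (V := A) cA by apply: dmod_module.
have hB : dmod M cR (V := B) cB by apply: dmod_module.
have guess := guessing (M := M) N_guess.
have trace_closed (V : lmodType R) (cV : coding U V) : dmod M cR (V := V) cV ->
    submod_closed (mem (trace cV N)).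
  move=> hV; split=> [|a u v]; rewrite !inE; first exact: (mset_mod0 hV).
  exact: (mset_modP RN hV).
exists (trace_closed A cA hA), (trace_closed B cB hB) => NA NB.
pose kA : mono NA A := exist _ _ (submod_val_mono _).
pose kB : mono NB B := exist _ _ (submod_val_mono _).
(* For B contained in N, the identity presents B as its own trace, so the last claim is the same
   lifting with [kid] in place of [kB]. *)
pose kid : mono B B := exist _ id (conj (fun a u v => erefl) (@inj_id B)).
have kcA : onto_trace M kA cA.
  move=> v; split=> [Nv|[x <-]]; last by have := valP x; rewrite inE.
  have vN : v \in trace cA N by rewrite inE.
  by exists (Submod (trace_closed A cA hA) vN).
have kcB : onto_trace M kB cB.
  move=> v; split=> [Nv|[x <-]]; last by have := valP x; rewrite inE.
  have vN : v \in trace cB N by rewrite inE.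
  by exists (Submod (trace_closed B cB hB) vN).
split=> [n|phi|BN phi].
- split.
  + exact: (ext_iso hR RN hA hB kcA kcB guess).
  + by move=> c; apply: (mset_ext_code hR RN hA hB).
  + exact: (ext_zero hR RN hA hB kcA kcB guess).
- have [g gphi] := lifts_ex hA hB kcA kcB guess phi.
  have gl := (lifts_linear RN hA hB kcA gphi).1 (linearP phi).
  by exists (to_linear gl) => x; apply: (proj2 gphi).
- have kcid : onto_trace M kid cB.
    by move=> v; split=> [_|_]; [exists v|apply: BN].
  have [g gphi] := lifts_ex hA hB kcA kcid guess phi.
  have gl := (lifts_linear RN hA hB kcA gphi).1 (linearP phi).
  by exists (to_linear gl) => x; apply: (proj2 gphi).
Qed.
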